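(* Let $n\ge 2$, let $\Omega\subset\mathbb{R}^n$ be a bounded $(\alpha,\beta)$-John domain, let $0<\delta\le n$ and $p\in(\delta/n,\delta)$. Then there exists a constant $c$ depending only on $n$, $\delta$, $p$, $\alpha$ and $\beta$ such that $$\inf_{b\in\mathbb{R}}\Big(\int_\Omega |u(x)-b|^{\frac{\delta p}{\delta-p}}\,d\mathcal{H}^\delta_\infty\Big)^{\frac{\delta-p}{\delta p}}\le c\Big(\int_\Omega|\nabla u(x)|^p\,d\mathcal{H}^\delta_\infty\Big)^{\frac1p}$$ for all $u\in C^1(\Omega)$.
   Context: A domain is an open, connected set in $\mathbb{R}^n$, $n\ge 2$. For $\delta\in(0,n]$ and $E\subset\mathbb{R}^n$, the $\delta$-dimensional Hausdorff content is $$\mathcal{H}^\delta_\infty(E):=\inf\Big\{\sum_{i} r_i^\delta : E\subset\bigcup_{i}B(x_i,r_i)\Big\},$$ the infimum being taken over all finite or countable coverings of $E$ by open balls $B(x_i,r_i)$. For $f:\Omega\to[0,\infty]$ the Choquet integral with respect to $\mathcal{H}^\delta_\infty$ is $$\int_\Omega f(x)\,d\mathcal{H}^\delta_\infty:=\int_0^\infty\mathcal{H}^\delta_\infty(\{x\in\Omega: f(x)>t\})\,dt .$$ A bounded domain $\Omega\subset\mathbb{R}^n$ is an $(\alpha,\beta)$-John domain, $0<\alpha\le\beta<\infty$, if there is a point $x_0\in\Omega$ such that each $x\in\Omega$ can be joined to $x_0$ by a rectifiable curve $\gamma_x:[0,\ell(\gamma_x)]\to\Omega$, parametrized by arc length,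 with $\gamma_x(0)=x$, $\gamma_x(\ell(\gamma_x))=x_0$, $\ell(\gamma_x)\le\beta$, and $\operatorname{dist}(\gamma_x(t),\partial\Omega)\ge\frac{\alpha}{\beta}t$ for all $t\in[0,\ell(\gamma_x)]$. $C^1(\Omega)$ denotes the continuously differentiable real-valued functions on $\Omega$. Integrals may take the value $\infty$. *)

(* Defs.v *)
From mathcomp Require Import all_boot all_order all_algebra.
From mathcomp Require Import all_classical all_reals all_analysis.

Set Implicit Arguments.
Unset Strict Implicit.
Unset Printing Implicit Defensive.

Import Order.TTheory GRing.Theory Num.Theory.
Import numFieldNormedType.Exports.

Local Open Scope classical_set_scope.
Local Open Scope ring_scope.

(* R^n is 'rV[R]_n. The library norm and balls on 'rV[R]_n
   are those of the sup norm, so the metric notions below are defined from the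
   Euclidean norm; the topological and boundedness notions of the library
   (open, connected, closure, continuous, differentiable, bounded_set) are the
   same for both norms. *)

Section Euclidean.
Context {R : realType} {n : nat}.
Implicit Types (x y : 'rV[R]_n) (A : set 'rV[R]_n).

Definition enorm x : R := Num.sqrt (\sum_(i < n) x ord0 i ^+ 2).

Definition eball x (r : R) : set 'rV[R]_n := [set y | enorm (y - x) < r].

(* +oo when A is empty *)
Definition edist_set x A : \bar R :=
  ereal_inf [set (enorm (x - y))%:E | y in A].

Definition boundary A : set 'rV[R]_n := closure A `\` A°.

Definition bounded_domain A : Prop := [/\ open A, connected A & bounded_set A].

End Euclidean.

Section Choquet.
Context {R : realType} {n : nat}.

(* The index set D is an arbitrary subset of nat, i.e. the coverings are finite
   or countable; radii are positive. *)
Definition hausdorff_content (delta : R) (E : set 'rV[R]_n) : \bar R :=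
  ereal_inf [set s | exists (D : set nat) (x : nat -> 'rV[R]_n) (r : nat -> R),
    [/\ forall i, D i -> 0 < r i,
        E `<=` \bigcup_(i in D) eball (x i) (r i) &
        s = (\esum_(i in D) (r i `^ delta)%:E)%E]].

(* Only the values of f on Omega matter. *)
Definition choquet_integral (delta : R) (Omega : set 'rV[R]_n)
    (f : 'rV[R]_n -> \bar R) : \bar R :=
  (\int[lebesgue_measure]_(t in `]0%R, +oo[)
     hausdorff_content delta [set x | Omega x /\ t%:E < f x])%E.

End Choquet.

Section John.
Context {R : realType} {n : nat}.

(* Length of g on [a, b]: supremum over the partitions a < s_0 < ... < b of the
   lengths of the inscribed polygonal lines; compare total_variation, which is
   for real-valued functions only. *)
Definition curve_length (a b : R) (g : R -> 'rV[R]_n) : \bar R :=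
  ereal_sup [set (\sum_(0 <= k < size s)
                    enorm (g (nth b (a :: s) k.+1) - g (nth b (a :: s) k)))%:E
            | s in itv_partition a b].

(* Being parametrized by arc length makes g rectifiable, of length l. *)
Definition arc_length_curve (l : R) (g : R -> 'rV[R]_n) : Prop :=
  {within `[0, l], continuous g} /\
  (forall t, 0 <= t <= l -> curve_length 0 t g = t%:E).

Definition john_domain (alpha beta : R) (Omega : set 'rV[R]_n) : Prop :=
  [/\ 0 < alpha <= beta, bounded_domain Omega &
   exists2 x0, Omega x0 &
   forall x, Omega x ->
   exists (l : R) (g : R -> 'rV[R]_n),
     [/\ 0 <= l <= beta,
         arc_length_curve l g,
         g 0 = x,
         g l = x0 &
         forall t, 0 <= t <= l ->
           Omega (g t) /\
           ((alpha / beta * t)%:E <= edist_set (g t) (boundary Omega))%E]].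

End John.

Section C1.
Context {R : realType} {n : nat}.

Definition gradient (u : 'rV[R]_n -> R) (x : 'rV[R]_n) : 'rV[R]_n :=
  \row_(i < n) 'D_(delta_mx ord0 i) u x.

(* Omega is meant to be open: then these conditions, and the gradient on Omega,
   only depend on the restriction of u to Omega. *)
Definition C1 (Omega : set 'rV[R]_n) (u : 'rV[R]_n -> R) : Prop :=
  (forall x, Omega x -> differentiable u x) /\
  {within Omega, continuous (gradient u)}.

End C1.

(* Main.v *)
Require Import Defs.
From mathcomp Require Import all_boot all_order all_algebra.
From mathcomp Require Import all_classical all_reals all_analysis.
From mathcomp Require Import measurable_realfun.
From mathcomp Require Import ring lra.

Set Implicit Arguments.
Unset Strict Implicit.
Unset Printing Implicit Defensive.

Import Order.TTheory GRing.Theory Num.Theory.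
Import numFieldNormedType.Exports.

Local Open Scope classical_set_scope.
Local Open Scope ring_scope.

(** The inequality is proved by averaging over random curves and by covering
    sets with balls; no n-dimensional integral occurs.

    Scaling.  Let [sg > 0] satisfy [int |grad u|^p dH <= sg^p].  It suffices to
    find [b] with [int |u - b|^q dH <= (C sg)^q], where
    [q = delta p / (delta - p)] and [C] depends only on the data
    ([poincare_at_scale]); then [sg] decreases to the [p]-th root of the integral.
    Put [G = |grad u| / sg].  Cutting the Choquet integral at the levels [2^k]
    and covering each [{G > 2^k}] almost optimally yields balls [B_i] with centre
    [c_i], radius [r_i] and level [k_i >= 0] such that
    [sum_i 2^(k_i p) r_i^delta <= tot] ([content_levels_sum], [level_covers]).
    Only nonnegative levels are needed because [Omega] is bounded, with a content
    controlled by [beta].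

    Exceptional sets.  Fix [s] strictly between [delta / n] and [p].  A point [x]
    belongs to the exceptional set [E_m] when, for some [t > 0], the balls of level
    at least [m] centred within [4t] of [x] have weight
    [sum 2^(k_i s) r_i^delta >= 2^(m s) t^delta].  This is a superlevel set of a
    maximal function of a discrete measure.  Measures are additive over disjoint
    balls, so a Vitali argument bounds the content of [E_m] by a multiple of
    [2^(-m s) sum_(k_i >= m) 2^(k_i s) r_i^delta] ([dense_set_content]).  Since
    [s < p], multiplying by [2^(m p)] and summing over [m] gives at most a multiple
    of [tot] ([sum_level_tail_le]): as in the Marcinkiewicz argument, a weak
    estimate at the exponent [s] gives a strong one at [p].

    Oscillation off the exceptional set.  Let [gam] be a John curve from [x] to
    the centre [x0] and perturb it to [gam t + c t w], with [w] uniform on a finite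
    grid of the unit cube; the John condition keeps these curves in [Omega].  At
    time [t] the perturbed point lies in [B_i] with probability at most a multiple
    of [(r_i / t)^n].  As [s n > delta], the mean of [G] at time [t] is at most
    a multiple of [2^m] if [x] is not in [E_m]; in any case it is at most a
    multiple of [t^(-delta/p)] ([grid_mean_le]).  Hence the mean of
    [|u(end of the curve) - u x|] grows at a speed which is at most a multiple of [sg] times
    the smaller of these bounds; splitting the time at [2^(-m p / delta)] gives
    a multiple of [sg 2^(m (1 - p/delta))] ([tube_end_mean_le]).  For the same [w],
    the curves of two points [x] and [y], run for the same time, have the same end,
    so [|u x - u y|] has this bound whenever [x] and [y] lie outside [E_m]
    ([john_oscillation]).

    Conclusion.  Let [b] be the value of [u] at a point outside the first [E_m]
    which does not contain [Omega].  Then [|u - b|^q > (C sg)^q 2^(m p)] forces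
    [x] into [E_m], and the summed contents of the [E_m] bound the integral. *)

(** * Supremum and Euclidean norms *)

Section EuclideanNorm.
Context {R : realType} {n : nat}.
Implicit Types v : 'rV[R]_n.

Lemma normr_le_coord v (r : R) :
  0 <= r -> (forall i, `|v ord0 i| <= r) -> `|v| <= r.
Proof.
move=> r0 vr; rewrite [leLHS]/Num.norm/= mx_normrE.
by apply/bigmax_leP; split => // -[i j] _ /=; rewrite ord1.
Qed.

Lemma coord_le_enorm v i : `|v ord0 i| <= enorm v.
Proof.
rewrite -sqrtr_sqr ler_wsqrtr// (bigD1 i)//= lerDl.
by apply: sumr_ge0 => j _; exact: sqr_ge0.
Qed.

Lemma normr_le_enorm v : `|v| <= enorm v.
Proof. by apply: normr_le_coord; [exact: sqrtr_ge0|exact: coord_le_enorm]. Qed.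

Lemma coord_le_normr v i : `|v ord0 i| <= `|v|.
Proof.
rewrite [leRHS]/Num.norm/= mx_normrE.
by apply/bigmax_geP; right; exists (ord0, i).
Qed.

Lemma enorm_le_normr v : enorm v <= n%:R * `|v|.
Proof.
have n0 : 0 <= n%:R * `|v| by rewrite mulr_ge0.
rewrite -(ger0_norm n0) -sqrtr_sqr ler_wsqrtr//.
apply: (@le_trans _ _ (\sum_(i < n) `|v| ^+ 2)).
  apply: ler_sum => i _.
  by rewrite -[leLHS]real_normK ?num_real// lerXn2r ?nnegrE// coord_le_normr.
rewrite sumr_const card_ord -[leLHS]mulr_natl exprMn ler_wpM2r ?sqr_ge0//.
by rewrite expr2 -natrM ler_nat; case: n => // m; rewrite leq_pmulr.
Qed.

End EuclideanNorm.

(** * Counting grid points *)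

Section Counting.
Context {R : realType}.

(** The right side comes from a potential: with [y = a / h + N] and [s = r / h], the
    count up to [N] is at most [y + s] clipped between 0 and [2 s + 1], a quantity that
    rises by exactly 1 each time the new term falls in the interval. *)
Lemma count_progression (a h r : R) (N : nat) : 0 < h -> 0 < r ->
  \sum_(j < N) (`|a + h * j%:R| < r)%R%:R <= 2 * r / h + 1.
Proof.
move=> h0 r0.
pose y N : R := a / h + N%:R; pose s : R := r / h.
have s0 : 0 < s by exact: divr_gt0.
suff : \sum_(j < N) (`|a + h * j%:R| < r)%R%:R
    <= Num.min (2 * s + 1) (Num.max 0 (y N + s)).
  by rewrite le_min /s mulrA => /andP[].
elim: N => [|N IH].
  by rewrite big_ord0 le_min le_max lexx/= andbT; lra.
rewrite big_ord_recr/=.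
have -> : (`|a + h * N%:R| < r) = (- s < y N < s).
  have -> : a + h * N%:R = h * y N by rewrite /y mulrDr mulrCA divff ?gt_eqF// mulr1.
  by rewrite normrM gtr0_norm// mulrC -ltr_pdivlMr// ltr_norml.
have -> : y N.+1 = y N + 1 by rewrite /y -addn1 natrD addrA.
move: IH; set S := \sum_(j < N) _; move: (y N) => z.
rewrite !le_min !le_max.
case: (ltrP (- s) z) => /= h1; case: (ltrP z s) => /= h2 => /andP[H1 H2];
  apply/andP; split; move: H2 => /orP[H2|H2]; try lra; apply/orP; first [by right; lra|by left; lra].
Qed.

End Counting.

Section Grid.
Context {R : realType} {n : nat}.

(** The points [grid_point f] form the uniform grid of mesh [1 / N] in the unit cube
    and [grid_mean] averages over it.  They play the role of a uniform random vector;
    a finite grid suffices because only finitely many balls, hence a smallest radius,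
    matter at a time. *)
Definition grid_point (N : nat) (f : {ffun 'I_n -> 'I_N}) : 'rV[R]_n :=
  \row_l ((f l)%:R / N%:R).

Definition grid_mean (N : nat) (F : {ffun 'I_n -> 'I_N} -> R) : R :=
  (\sum_f F f) / N%:R ^+ n.

(** A Euclidean ball lies in a box, and the hits of a box factor over the coordinates,
    each of which is an arithmetic progression of step [h / N].  The mesh condition
    [h / r <= N] absorbs the additive 1 of the one-dimensional count. *)
Lemma grid_mean_ball (N : nat) (z c : 'rV[R]_n) (h r : R) :
  0 < h -> 0 < r -> h / r <= N.+1%:R ->
  grid_mean (fun f : {ffun 'I_n -> 'I_N.+1} => (enorm (z + h *: grid_point f - c) < r)%R%:R)
    <= (3 * r / h) ^+ n.
Proof.
move=> h0 r0 hrN; rewrite /grid_mean ler_pdivrMr ?exprn_gt0// -exprMn.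
pose P l (j : 'I_N.+1) := `|(z - c) ord0 l + h / N.+1%:R * j%:R| < r.
apply: (@le_trans _ _ (\sum_(f : {ffun 'I_n -> 'I_N.+1}) \prod_l (P l (f l))%:R)).
  apply: ler_sum => f _; case: ltrP => [zr|_]; last first.
    by apply: prodr_ge0.
  rewrite big1// => l _; rewrite /P; case: ltrP => //.
  have := le_lt_trans (coord_le_enorm _ l) zr.
  suff -> : (z - c) ord0 l + h / N.+1%:R * (f l)%:R
      = (z + h *: grid_point f - c) ord0 l by move=> /lt_geF ->.
  by rewrite !mxE addrAC mulrAC mulrA.
rewrite -(bigA_distr_bigA (fun l j => (P l j)%:R)).
have -> : (3 * r / h * N.+1%:R) ^+ n = \prod_(l < n) (3 * r / h * N.+1%:R).
  by rewrite prodr_const card_ord.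
apply: ler_prod => l _; rewrite sumr_ge0//=.
have hN : 0 < h / N.+1%:R by rewrite divr_gt0.
apply: (le_trans (count_progression ((z - c) ord0 l) N.+1 hN r0)).
have hr1 : 1 <= r / h * N.+1%:R.
  by rewrite mulrC -ler_pdivrMr ?divr_gt0// mul1r invf_div.
have -> : 2 * r / (h / N.+1%:R) = 2 * (r / h * N.+1%:R).
  by rewrite invf_div -!mulrA [N.+1%:R / h]mulrC.
by rewrite -[3 * r / h]mulrA -[leRHS]mulrA; lra.
Qed.

End Grid.

(** * Means over a grid *)

Section WeightedCount.
Context {R : realType}.

Lemma powR_expR (a s : R) : 0 < a -> a `^ s = expR (s * ln a).
Proof. by move=> a0; rewrite /powR gt_eqF. Qed.

(** In logarithms [A = ln a >= 0] and [B = ln b] this is a linear inequality, with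
    [delta <= s N] making the coefficient of [A] nonpositive after [B] is eliminated. *)
Lemma mul_exprn_le_powR (a b s delta : R) (N : nat) :
  1 <= a -> 0 < b -> 0 < delta <= N%:R -> delta <= s * N%:R ->
  a `^ s * b `^ delta <= 1 -> a * b ^+ N <= a `^ s * b `^ delta.
Proof.
move=> a1 b0 /andP[d0 dN] dsN; have a0 : 0 < a by lra.
have -> : a * b ^+ N = a `^ 1 * b `^ N%:R by rewrite powRr1 ?ltW// powR_mulrn ?ltW.
rewrite !powR_expR// -!expRD -[X in _ <= X -> _]expR0 !ler_expR => le0.
have A0 : 0 <= ln a by rewrite ln_ge0.
move: (ln a) (ln b) A0 le0 => A B A0 le0.
suff : delta * ((1 - s) * A + (N%:R - delta) * B) <= 0 by rewrite pmulr_rle0//; lra.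
have := mulr_ge0_le0 (_ : 0 <= N%:R - delta) le0; rewrite subr_ge0 => /(_ dN).
have : 0 <= (s * N%:R - delta) * A by rewrite mulr_ge0// subr_ge0.
nra.
Qed.

(** The step where [s >= delta / N] is used: a bound on the [delta]-dimensional mass of a
    family of balls, weighted by [y^s], controls its [N]-dimensional mass weighted by
    [y], as long as the weights [y] stay above [lam].  Termwise it is
    [mul_exprn_le_powR] for [y / lam] and [r / t]. *)
Lemma sum_mul_exprn_le (I : eqType) (J : seq I) (P : pred I) (y r : I -> R)
    (s delta lam t : R) (N : nat) :
  0 < delta <= N%:R -> delta <= s * N%:R -> 0 < lam -> 0 < t ->
  {in J, forall i, 0 < r i} -> (forall i, P i -> lam <= y i) ->
  \sum_(i <- J | P i) y i `^ s * r i `^ delta <= lam `^ s * t `^ delta ->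
  \sum_(i <- J | P i) y i * r i ^+ N <= lam * t ^+ N.
Proof.
move=> dN dsN l0 t0 r0 ly; set W := lam `^ s * t `^ delta => sW.
have W0 : 0 < W by rewrite mulr_gt0 ?powR_gt0.
have lt0 : 0 < lam * t ^+ N by rewrite mulr_gt0// exprn_gt0.
have w0 i : 0 <= y i `^ s * r i `^ delta by rewrite mulr_ge0 ?powR_ge0.
have le1 i : i \in J -> P i ->
    y i * r i ^+ N <= (y i `^ s * r i `^ delta) / W * (lam * t ^+ N).
  move=> iJ Pi; have ri := r0 _ iJ; have li := ly _ Pi.
  have yi : 0 < y i by exact: lt_le_trans li.
  have aE : (y i / lam) `^ s * (r i / t) `^ delta = (y i `^ s * r i `^ delta) / W.
    by rewrite !powR_expR ?divr_gt0// /W !powR_expR// -!expRD -expRN -expRD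
      !ln_div ?posrE//; congr expR; ring.
  have := @mul_exprn_le_powR (y i / lam) (r i / t) s delta N.
  rewrite aE ler_pdivlMr// mul1r divr_gt0// => /(_ li isT dN dsN).
  have wW : y i `^ s * r i `^ delta <= 1 * W.
    by rewrite mul1r; apply: le_trans sW; rewrite (big_rem i)//= Pi lerDl sumr_ge0.
  rewrite ler_pdivrMr// => /(_ wW).
  have -> : y i / lam * (r i / t) ^+ N = y i * r i ^+ N / (lam * t ^+ N).
    by rewrite expr_div_n; field; rewrite !gt_eqF ?exprn_gt0.
  by rewrite ler_pdivrMr.
apply: (@le_trans _ _ ((\sum_(i <- J | P i) (y i `^ s * r i `^ delta)) / W * (lam * t ^+ N))).
  rewrite !mulr_suml big_seq_cond [leRHS]big_seq_cond.
  by apply: ler_sum => i /andP[]; exact: le1.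
by rewrite ler_piMl ?(ltW lt0)// ler_pdivrMr// mul1r.
Qed.

End WeightedCount.

Section GridMeanBound.
Context {R : realType} {n : nat}.
Local Notation gmean := (@grid_mean R n).

(** Mean of [G] at the perturbed position [z + c t w].  Where [G >= 4 lam] the point lies
    in one of the balls of [J] with [2^(lev i) > G / 4 >= lam], so [G] is at most
    [4 lam] plus the sum of [4 2^(lev i)] over the balls hit; taking means,
    the probability of a hit is at most [(3 rad i / (c t))^n]. *)
Lemma grid_mean_le (I : eqType) (J : seq I) (lev : I -> nat) (cen : I -> 'rV[R]_n)
    (rad : I -> R) (near : pred I) (G : 'rV[R]_n -> R) (z : 'rV[R]_n)
    (N : nat) (s delta lam c t : R) :
  0 < delta <= n%:R -> delta <= s * n%:R -> 1 <= 2 * lam -> 0 < c -> 0 < t ->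
  {in J, forall i, 0 < rad i /\ c * t / rad i <= N.+1%:R} ->
  (forall f : {ffun 'I_n -> 'I_N.+1}, {in J, forall i,
     enorm (z + (c * t) *: grid_point f - cen i) < rad i -> near i}) ->
  (forall f : {ffun 'I_n -> 'I_N.+1},
     G (z + (c * t) *: grid_point f) < 2 \/
     exists i, [/\ i \in J, enorm (z + (c * t) *: grid_point f - cen i) < rad i &
        G (z + (c * t) *: grid_point f) < 4 * 2 ^+ lev i]) ->
  \sum_(i <- J | near i && (lam <= 2 ^+ lev i))
     (2 ^+ lev i) `^ s * rad i `^ delta <= lam `^ s * t `^ delta ->
  gmean (fun f : {ffun 'I_n -> 'I_N.+1} => G (z + (c * t) *: grid_point f))
    <= 4 * (1 + (3 / c) ^+ n) * lam.
Proof.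
move=> dn dsn l1 c0 t0 J0 nearP cov sumle; have l0 : 0 < lam by lra.
have ct0 : 0 < c * t by rewrite mulr_gt0.
pose hit i (f : {ffun 'I_n -> 'I_N.+1}) : R :=
  (enorm (z + (c * t) *: grid_point f - cen i) < rad i)%R%:R.
pose P i := near i && (lam <= 2 ^+ lev i).
have Gle f : G (z + (c * t) *: grid_point f)
    <= 4 * lam + \sum_(i <- J | P i) 4 * 2 ^+ lev i * hit i f.
  have h0 i : 0 <= 4 * 2 ^+ lev i * hit i f by rewrite !mulr_ge0 ?exprn_ge0.
  have S0 : 0 <= \sum_(i <- J | P i) 4 * 2 ^+ lev i * hit i f by apply: sumr_ge0.
  have [G2|[i [iJ zi Gi]]] := cov f; first lra.
  have [li|li] := leP lam (2 ^+ lev i); last lra.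
  rewrite (big_rem i)//= /P (nearP f i iJ zi) li/= /hit zi mulr1.
  apply: ltW; apply: (lt_le_trans Gi); rewrite addrCA lerDl addr_ge0//; first lra.
  by apply: sumr_ge0.
have N0 : 0 < N.+1%:R ^+ n :> R by rewrite exprn_gt0.
have hitle i : i \in J -> \sum_f hit i f <= (3 / (c * t)) ^+ n * rad i ^+ n * N.+1%:R ^+ n.
  move=> iJ; have [ri rN] := J0 _ iJ; have := grid_mean_ball z (cen i) ct0 ri rN.
  by rewrite /grid_mean ler_pdivrMr// -(exprMn _ (3 / _)) mulrAC.
rewrite /grid_mean ler_pdivrMr//.
apply: (@le_trans _ _ (\sum_(f : {ffun 'I_n -> 'I_N.+1}) (4 * lam +
    \sum_(i <- J | P i) 4 * 2 ^+ lev i * hit i f))); first by apply: ler_sum.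
rewrite big_split/= sumr_const card_ffun !card_ord -[_ *+ (_ ^ _)]mulr_natr natrX.
rewrite exchange_big/=.
have : \sum_(i <- J | P i) \sum_(f : {ffun 'I_n -> 'I_N.+1}) 4 * 2 ^+ lev i * hit i f
   <= \sum_(i <- J | P i) (2 ^+ lev i * rad i ^+ n) *
       (4 * (3 / (c * t)) ^+ n * N.+1%:R ^+ n).
  rewrite big_seq_cond [leRHS]big_seq_cond.
  apply: ler_sum => i /andP[iJ _]; rewrite -mulr_sumr.
  have := hitle _ iJ; set X := \sum_f _ => hX.
  have -> : 2 ^+ lev i * rad i ^+ n * (4 * (3 / (c * t)) ^+ n * N.+1%:R ^+ n) =
     4 * 2 ^+ lev i * ((3 / (c * t)) ^+ n * rad i ^+ n * N.+1%:R ^+ n) :> R by ring.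
  by rewrite ler_wpM2l// mulr_ge0// exprn_ge0.
have rad0 : {in J, forall i, 0 < rad i} by move=> i /J0[].
have levP i : P i -> lam <= 2 ^+ lev i by case/andP.
have := sum_mul_exprn_le dn dsn l0 t0 rad0 levP sumle.
rewrite -mulr_suml; set Y := \sum_(i <- J | P i) _ * _ => Yle Xle.
have K0 : 0 <= 4 * (3 / (c * t)) ^+ n * N.+1%:R ^+ n.
  by rewrite !mulr_ge0 ?exprn_ge0// divr_ge0// ltW.
have := ler_wpM2r K0 Yle.
have -> : lam * t ^+ n * (4 * (3 / (c * t)) ^+ n * N.+1%:R ^+ n) =
    4 * (3 / c) ^+ n * lam * N.+1%:R ^+ n.
  have -> : (3 / c) ^+ n = (3 / (c * t)) ^+ n * t ^+ n.
    by rewrite -exprMn; congr (_ ^+ _); field; rewrite !gt_eqF.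
  ring.
by lra.
Qed.

End GridMeanBound.

(** * Monotonicity from a Dini derivative *)

Section DiniMonotone.
Context {R : realType}.

(** A continuous function whose upper right Dini derivative is nonpositive inside the
    interval does not increase: otherwise consider the infimum of the points where [h]
    exceeds [h a + e (1 + t - a)].  The constant [e] in this line gives room at [a],
    where the Dini condition is not assumed. *)
Lemma dini_nonincreasing (h : R -> R) (a b : R) : a <= b ->
  (forall t, a <= t <= b -> forall e, 0 < e ->
     exists2 d, 0 < d & forall s, a <= s <= b -> `|s - t| < d -> `|h s - h t| < e) ->
  (forall t, a < t < b -> forall e, 0 < e ->
     exists2 d, 0 < d & forall s, t <= s < t + d -> s <= b -> h s <= h t + e * (s - t)) ->
  h b <= h a.
Proof.
move=> ab hc hd; apply/ler_addgt0Pr => e0 e00.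
set e := e0 / (1 + b - a).
have ba0 : 0 < 1 + b - a by lra.
have e_gt0 : 0 < e by rewrite divr_gt0.
have -> : e0 = e * (1 + b - a) by rewrite divfK ?gt_eqF.
rewrite leNgt; apply/negP => hb.
pose k t := h a + e * (1 + t - a).
pose B := [set t | a <= t <= b /\ k t < h t].
have Bb : B b by split; [rewrite ab lexx|].
have lbB : lbound B a by move=> t [/andP[]].
have infB : has_inf B by split; [exists b|exists a].
set t0 := inf B.
have at0 : a <= t0 by apply: lb_le_inf => //; exists b.
have t0b : t0 <= b by apply: ge_inf => //; exists a.
have notB t : a <= t < t0 -> h t <= k t.
  move=> /andP[ta tt0]; rewrite leNgt; apply/negP => kt.
  have : B t by split => //; lra.
  by move=> /(ge_inf (ex_intro _ a lbB)); rewrite leNgt tt0.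
have kt0 : h t0 <= k t0.
  have [->|at0'] := eqVneq t0 a; first by rewrite /k; nra.
  have {}at0' : a < t0 by rewrite lt_neqAle eq_sym at0'.
  rewrite leNgt; apply/negP => kt0.
  have t0ab : a <= t0 <= b by rewrite at0.
  have [|d d0 hs] := hc t0 t0ab (h t0 - k t0); first lra.
  pose s := Num.max a (t0 - d / 2).
  have sE : a <= s /\ t0 - d / 2 <= s /\ s < t0.
    by rewrite /s; case: (leP a (t0 - d / 2)) => ?; lra.
  have := notB s; have := hs s; rewrite ltr_norml ltr_norml /k.
  have -> : (a <= s <= b) = true by lra.
  have -> : (- d < s - t0 < d) = true by lra.
  move=> /(_ isT isT) h1 h2.
  have : h s <= h a + e * (1 + s - a) by apply: h2; lra.
  by move: h1; rewrite /k; nra.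
have [d d0 hs] : exists2 d, 0 < d & forall s, t0 <= s < t0 + d -> s <= b -> h s <= k s.
  have [t0a|at0'] := eqVneq t0 a.
    have t0ab : a <= t0 <= b by rewrite at0.
    have [d d0 hs] := hc t0 t0ab e e_gt0; exists d => // s s1 sb.
    have := hs s; have -> : (a <= s <= b) = true by lra.
    have -> : `|s - t0| < d by rewrite ltr_norml; lra.
    rewrite ltr_norml /k => /(_ isT isT); rewrite t0a in s1 *.
    have : 0 <= e * (s - a) by rewrite mulr_ge0; lra.
    lra.
  have [t0b'|bt0'] := eqVneq t0 b.
    exists 1 => // s s1 sb; suff -> : s = t0 by [].
    by lra.
  have [||d d0 hs] := hd t0 _ e; rewrite ?e_gt0//.
    by rewrite !lt_neqAle at0 t0b bt0' eq_sym at0'.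
  exists d => // s s1 sb; apply: le_trans (hs _ s1 sb) _.
  by move: kt0; rewrite /k; lra.
have [t [/andP[ta tb] kt] tt0] := inf_adherent d0 infB.
have : h t <= k t.
  apply: hs => //; rewrite tt0 andbT; apply: ge_inf; last by split; [rewrite ta|].
  by exists a.
by lra.
Qed.

End DiniMonotone.

(** * Local bounds by the gradient *)

Section LocalLipschitz.
Context {R : realType} {n : nat}.
Implicit Types (u : 'rV[R]_n -> R) (z v : 'rV[R]_n).

Lemma norm_diff_le u z v : differentiable u z ->
  `|'d u z v| <= n%:R * enorm (gradient u z) * `|v|.
Proof.
move=> du; rewrite {1}[v]row_sum_delta linear_sum/=.
apply: le_trans (ler_norm_sum _ _ _) _.
have nE : n%:R = \sum_(i < n) 1 :> R by rewrite sumr_const card_ord.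
rewrite -mulrA nE mulr_suml.
apply: ler_sum => i _; rewrite mul1r linearZ/= normrM mulrC.
apply: ler_pM => //; last exact: coord_le_normr.
by apply: le_trans (coord_le_enorm _ i); rewrite mxE deriveE.
Qed.

(** A one-point estimate with the gradient at the same point: differentiability alone
    gives it, and it is what a Dini derivative along a Lipschitz curve requires. *)
Lemma differentiable_local_lipschitz u z e : differentiable u z -> 0 < e ->
  exists2 d, 0 < d & forall y, `|y - z| < d ->
    `|u y - u z| <= (n%:R * enorm (gradient u z) + e) * `|y - z|.
Proof.
move=> du e0; have /eqaddoP/(_ _ e0) := diff_locally du.
move=> /nbhs_ballP[d d0 od]; exists d => // y yzd.
have := od (y - z); rewrite -ball_normE/= sub0r normrN => /(_ yzd).
rewrite !fctE/= subrK => ode.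
rewrite mulrDl -[u y - u z](subrK ('d u z (y - z))) addrC.
apply: le_trans (ler_normD _ _) _.
by apply: lerD; [exact: norm_diff_le|rewrite -addrA -opprD].
Qed.

End LocalLipschitz.

(** * Perturbed curves *)

Section Tube.
Context {R : realType} {n : nat}.
Implicit Types (gam : R -> 'rV[R]_n) (c t : R).

Lemma norm_grid_point_le N (f : {ffun 'I_n -> 'I_N}) : `|@grid_point R n N f| <= 1.
Proof.
apply: normr_le_coord => // i; rewrite mxE ger0_norm ?divr_ge0//.
have Nf := ltn_ord (f i).
rewrite ler_pdivrMr ?mul1r ?ler_nat ?ltr0n; [exact: ltnW|exact: leq_ltn_trans Nf].
Qed.

Lemma grid_mean_mono N (F F' : {ffun 'I_n -> 'I_N.+1} -> R) :
  (forall f, F f <= F' f) -> grid_mean F <= grid_mean F'.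
Proof. by move=> FF; rewrite ler_pM2r ?invr_gt0 ?exprn_gt0// ler_sum. Qed.

Lemma grid_mean_affine N (F F' : {ffun 'I_n -> 'I_N.+1} -> R) (a b : R) :
  grid_mean (fun f => F f + a * F' f + b) = grid_mean F + a * grid_mean F' + b.
Proof.
rewrite /grid_mean !big_split/= -mulr_sumr sumr_const card_ffun !card_ord.
rewrite -[b *+ _]mulr_natr natrX.
have : N.+1%:R ^+ n != 0 :> R by rewrite expf_neq0// pnatr_eq0.
by move: (N.+1%:R ^+ n) => K K0; field.
Qed.

Definition tube_point gam c t N (f : {ffun 'I_n -> 'I_N}) : 'rV[R]_n :=
  gam t + (c * t) *: grid_point f.

Lemma tube_point_lipschitz gam c N (f : {ffun 'I_n -> 'I_N}) s t :
  (forall s t, `|gam s - gam t| <= `|s - t|) -> 0 <= c <= 1 ->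
  `|tube_point gam c s f - tube_point gam c t f| <= 2 * `|s - t|.
Proof.
move=> lip /andP[c0 c1]; rewrite /tube_point opprD addrACA -scalerBl -mulrBr.
apply: le_trans (ler_normD _ _) _; rewrite normrZ normrM (ger0_norm c0).
have := lip s t; have := norm_grid_point_le f; have := normr_ge0 (s - t).
move: `|s - t| `|gam s - gam t| (normr_ge0 (@grid_point R n N f)) => x y.
move: `|grid_point f| => g g0 x0 g1 yx.
have : c * x * g <= x by rewrite -[leRHS]mul1r -mulrA ler_pM ?mulr_ge0// ler_piMr.
lra.
Qed.

Lemma min_pos_fin (T : finType) (P : T -> R -> Prop) :
  (forall f d d', P f d -> 0 < d' <= d -> P f d') ->
  (forall f, exists2 d, 0 < d & P f d) -> exists2 d, 0 < d & forall f, P f d.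
Proof.
move=> Pmono /(_ _)/cid2-/all_sig2[d d0 Pd].
exists (\big[Num.min/1]_f d f); first by apply/bigmin_gtP; split.
move=> f; apply: (Pmono f (d f)) => //; rewrite bigmin_le_cond// andbT.
by apply/bigmin_gtP; split.
Qed.

(** The mean of [|u - w|] along the perturbed curves has upper right Dini derivative at
    most [2 n] times the mean of the gradient: the curves are 2-Lipschitz and [n] bounds
    the ratio of the sum norm of the gradient to its Euclidean norm.  The function
    [phi] stands for a primitive of this bound. *)
Lemma tube_mean_variation (Omega : set 'rV[R]_n) u gam c N (phi : R -> R) (a b w : R) :
  (forall z, Omega z -> differentiable u z) ->
  (forall s t, `|gam s - gam t| <= `|s - t|) -> 0 <= c <= 1 -> a <= b ->
  (forall t, a <= t <= b -> forall f : {ffun 'I_n -> 'I_N.+1},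
     Omega (tube_point gam c t f)) ->
  (forall t, a <= t <= b -> {for t, continuous phi}) ->
  (forall t, a < t < b -> forall e, 0 < e ->
     exists2 d, 0 < d & forall s, t <= s < t + d ->
       2 * n%:R * grid_mean (fun f : {ffun 'I_n -> 'I_N.+1} =>
          enorm (gradient u (tube_point gam c t f))) * (s - t)
         <= phi s - phi t + e * (s - t)) ->
  grid_mean (fun f : {ffun 'I_n -> 'I_N.+1} => `|u (tube_point gam c b f) - w|)
   <= grid_mean (fun f : {ffun 'I_n -> 'I_N.+1} => `|u (tube_point gam c a f) - w|)
      + (phi b - phi a).
Proof.
move=> du lip c01 ab tub cphi dphi.
pose m t := grid_mean (fun f : {ffun 'I_n -> 'I_N.+1} => `|u (tube_point gam c t f) - w|).
rewrite -/(m a) -/(m b).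
suff : m b - phi b <= m a - phi a by lra.
apply: (@dini_nonincreasing R (fun t => m t - phi t)) => //.
  move=> t tab e e0.
  have e30 : 0 < e / 3 by rewrite divr_gt0.
  have := cphi t tab; move=> /cvgrPdist_lt/(_ _ e30)/nbhs_ballP[d1 /= d10 phi1].
  have [|f|d d0 Pd] := @min_pos_fin {ffun 'I_n -> 'I_N.+1} (fun f d => forall s, `|s - t| < d ->
      `|u (tube_point gam c s f) - u (tube_point gam c t f)| < e / 3).
  - by move=> f d d' Pd /andP[d0 dd] s sd; apply: Pd; exact: lt_le_trans dd.
  - have /differentiable_continuous/cvgrPdist_lt/(_ _ e30) := du _ (tub _ tab f).
    move=> /nbhs_ballP[d /= d0 ud]; exists (d / 2); first by rewrite divr_gt0.
    move=> s std; rewrite distrC; apply: ud; rewrite -ball_normE/= distrC.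
    apply: le_lt_trans (tube_point_lipschitz f s t lip c01) _.
    by rewrite mulrC -ltr_pdivlMr.
  exists (Num.min d d1); first by rewrite lt_min d0 d10.
  move=> s _; rewrite lt_min => /andP[sd sd1].
  have : `|phi t - phi s| < e / 3 by apply: phi1; rewrite /ball/= distrC.
  have lem x y : (forall f : {ffun 'I_n -> 'I_N.+1},
      `|u (tube_point gam c x f) - u (tube_point gam c y f)| < e / 3) -> m x <= m y + e / 3.
    move=> H; have -> : m y + e / 3 = m y + 0 * m y + e / 3 by ring.
    rewrite -grid_mean_affine; apply: grid_mean_mono => f; rewrite mul0r addr0.
    have := H f; have := ler_normD (u (tube_point gam c x f) - u (tube_point gam c y f))
      (u (tube_point gam c y f) - w); rewrite addrA subrK; lra.
  have : m s <= m t + e / 3 by apply: lem => f; exact: Pd.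
  have : m t <= m s + e / 3 by apply: lem => f; rewrite distrC; exact: Pd.
  by rewrite !ltr_norml; lra.
move=> t tab e e0.
have tab' : a <= t <= b by lra.
have e20 : 0 < e / 2 by rewrite divr_gt0.
have e40 : 0 < e / 4 by rewrite divr_gt0.
have [d1 d10 H1] := dphi t tab _ e20.
pose g (f : {ffun 'I_n -> 'I_N.+1}) := enorm (gradient u (tube_point gam c t f)).
have [|f|d d0 Pd] := @min_pos_fin {ffun 'I_n -> 'I_N.+1} (fun f d => forall s, t <= s < t + d ->
    `|u (tube_point gam c s f) - u (tube_point gam c t f)|
       <= 2 * n%:R * (s - t) * g f + e / 2 * (s - t)).
- by move=> f d d' Pd /andP[d0 dd] s sd; apply: Pd; lra.
- have [d d0 ud] := differentiable_local_lipschitz (du _ (tub _ tab' f)) e40.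
  exists (d / 2); first by rewrite divr_gt0.
  move=> s /andP[ts std].
  have lipst := tube_point_lipschitz f s t lip c01.
  have stE : `|s - t| = s - t by rewrite ger0_norm// subr_ge0.
  apply: le_trans (ud _ _) _.
    by apply: le_lt_trans lipst _; rewrite stE; lra.
  rewrite stE in lipst; rewrite -/(g f).
  have ng : 0 <= n%:R * g f + e / 4 by rewrite addr_ge0 ?mulr_ge0 ?sqrtr_ge0// ltW.
  by apply: le_trans (ler_wpM2l ng lipst) _; lra.
exists (Num.min d d1); first by rewrite lt_min d0 d10.
move=> s; rewrite -ltrBlDl lt_min !ltrBlDl => /and3P[ts sd sd1] sb.
have : m s <= m t + 2 * n%:R * (s - t) * grid_mean g + e / 2 * (s - t).
  rewrite /m -grid_mean_affine; apply: grid_mean_mono => f.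
  have := Pd f s; rewrite ts sd => /(_ isT).
  have := ler_normD (u (tube_point gam c s f) - u (tube_point gam c t f))
      (u (tube_point gam c t f) - w); rewrite addrA subrK; lra.
have := H1 s; rewrite ts sd1 => /(_ isT); rewrite -/(grid_mean g).
by move: (grid_mean g) => G; lra.
Qed.

End Tube.

(** * Balls of given levels and exceptional sets *)

Section LevelCover.
Context {R : realType} {n : nat}.

Lemma continuous_enorm : continuous (@enorm R n).
Proof.
move=> v; apply: (@continuous_comp _ _ _ (fun v : 'rV[R]_n => \sum_(i < n) v ord0 i ^+ 2)).
  suff : forall s : seq 'I_n,
      {for v, continuous (fun v : 'rV[R]_n => \sum_(i <- s) v ord0 i ^+ 2)} by exact.
  elim=> [|i s IH].
    have -> : (fun v : 'rV[R]_n => \sum_(i <- [::]) v ord0 i ^+ 2) = cst 0.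
      by apply/funext => z; rewrite big_nil.
    exact: cst_continuous.
  have -> : (fun v : 'rV[R]_n => \sum_(j <- i :: s) v ord0 j ^+ 2)
      = (fun v => v ord0 i * v ord0 i + \sum_(j <- s) v ord0 j ^+ 2).
    by apply/funext => z; rewrite big_cons.
  apply: continuousD; last exact: IH.
  by apply: continuousM; exact: coord_continuous.
exact: sqrt_continuous.
Qed.

Lemma open_eball (c : 'rV[R]_n) r : open [set z | enorm (z - c) < r].
Proof.
have -> : [set z | enorm (z - c) < r] = (fun z => enorm (z - c)) @^-1` [set s | s < r] by [].
apply: open_comp; last exact: open_lt.
move=> z _; apply: (@continuous_comp 'rV[R]_n 'rV[R]_n R (fun z => z - c) (@enorm R n)).
  by apply: continuousB; [by move=> A|exact: cst_continuous].
exact: continuous_enorm.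
Qed.

(** On a compact set finitely many balls suffice.  A point with [G >= 2] has the level [k]
    with [2^k < G <= 2^(k+1)], and the ball of that level around it, cut by
    [G < 4 2^k], is open; the index [None] stands for the open set [G < 2]. *)
Lemma level_cover_finite (Omega K : set 'rV[R]_n) (G : 'rV[R]_n -> R)
    (D : set (nat * nat)) (cen : nat * nat -> 'rV[R]_n) (rad : nat * nat -> R) :
  open Omega -> {in Omega, continuous G} -> compact K -> K `<=` Omega ->
  (forall k z, Omega z -> 2 ^+ k < G z ->
     exists j, D (k, j) /\ enorm (z - cen (k, j)) < rad (k, j)) ->
  exists J : seq (nat * nat), [/\ uniq J, {in J, forall i, D i} &
    forall z, K z -> G z < 2 \/
      exists i, [/\ i \in J, enorm (z - cen i) < rad i & G z < 4 * 2 ^+ i.1]].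
Proof.
move=> oO cG cK KO cov.
pose F (o : option (nat * nat)) : set 'rV[R]_n :=
  if o is Some i then
    [set z | enorm (z - cen i) < rad i] `&` (Omega `&` G @^-1` [set s | s < 4 * 2 ^+ i.1])
  else Omega `&` G @^-1` [set s | s < 2].
pose D' : set (option (nat * nat)) := fun o => if o is Some i then D i else True.
have oG s : open (Omega `&` G @^-1` [set r | r < s]).
  by apply: (continuous_inP G oO).1 => //; exact: open_lt.
have oF o : D' o -> open (F o).
  case: o => [i|] _ /=; last exact: oG.
  by apply: openI; [exact: open_eball|exact: oG].
have KF : K `<=` cover D' F.
  move=> z Kz; have Oz := KO _ Kz.
  have [G2|G2] := ltP (G z) 2; first by exists None.
  have exk : exists k, G z <= 2 ^+ k.+1.
    have := archi_boundP (le_trans (ler0n R 2) G2); set N := Num.bound _ => GN.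
    exists N; apply: (le_trans (ltW GN)); rewrite -natrX ler_nat.
    by rewrite ltnW// ltnW// ltn_expl.
  case: (ex_minnP exk) => k Gk mink.
  have kG : 2 ^+ k < G z.
    case: k Gk mink => [|k] _ mink; first by rewrite expr0; apply: lt_le_trans G2; rewrite ltr1n.
    by rewrite ltNge; apply/negP => /mink; rewrite ltnn.
  have [j [Dj zj]] := cov _ _ Oz kG.
  exists (Some (k, j)) => //=; split => //; split => //=.
  by apply: (le_lt_trans Gk); rewrite exprS ltr_pM2r ?exprn_gt0// ltr_nat.
move: cK; rewrite compact_cover => /(_ _ D' F oF KF)[D'' sD KD''].
exists (undup (pmap id (finmap.enum_fset D''))); split; first exact: undup_uniq.
  move=> i; rewrite mem_undup mem_pmap map_id => /sD.
  by rewrite inE.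
move=> z /KD''[[i|] /= iD'' [] ]; last by left.
move=> zi [_ Gi]; right; exists i; split => //.
by rewrite mem_undup mem_pmap map_id.
Qed.

End LevelCover.

Section Pointwise.
Context {R : realType} {n : nat}.
Context (D : set (nat * nat)) (cen : nat * nat -> 'rV[R]_n) (rad : nat * nat -> R).

(** The exceptional set of level [m]: where the maximal function, normalised by
    [t^delta], of the discrete measure with mass [2^(k s) r^delta] at the centre of each
    ball of level [k >= m] and radius [r] reaches [2^(m s)].  The balls are indexed by
    pairs (level, number), and finite subfamilies replace the total mass. *)
Definition dense_set (delta s : R) (m : nat) : set 'rV[R]_n :=
  [set x | exists t S, [/\ 0 < t, uniq S,
     {in S, forall i : nat * nat, [/\ D i, (m <= i.1)%N & `|cen i - x| < 4 * t]} &
     (2 ^+ m) `^ s * t `^ delta <= \sum_(i <- S) (2 ^+ i.1) `^ s * rad i `^ delta]].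

Lemma grid_meanZ N (F : {ffun 'I_n -> 'I_N.+1} -> R) (a : R) :
  grid_mean (fun f => a * F f) = a * grid_mean F.
Proof. by rewrite /grid_mean -mulr_sumr mulrA. Qed.

(** Outside the exceptional set the balls that the perturbed curve can hit at time [t]
    are centred within [4 t] of [x].  A hit gives only [|cen i - x| < 2 t + rad i], but
    [|cen i - x| < 3 rad i] would make [x] exceptional through the single ball [i] at
    scale [rad i]; so [rad i <= t]. *)
Lemma grid_mean_le_off_dense_set (delta s c t : R) (m N : nat) (J : seq (nat * nat))
    (x y : 'rV[R]_n) (G : 'rV[R]_n -> R) :
  0 < delta <= n%:R -> delta <= s * n%:R -> 0 < s -> 0 < c <= 1 -> 0 < t -> `|y - x| <= t ->
  ~ dense_set delta s m x ->
  uniq J -> {in J, forall i, [/\ D i, 0 < rad i & c * t / rad i <= N.+1%:R]} ->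
  (forall f : {ffun 'I_n -> 'I_N.+1},
     G (y + (c * t) *: grid_point f) < 2 \/
     exists i, [/\ i \in J, enorm (y + (c * t) *: grid_point f - cen i) < rad i &
        G (y + (c * t) *: grid_point f) < 4 * 2 ^+ i.1]) ->
  grid_mean (fun f : {ffun 'I_n -> 'I_N.+1} => G (y + (c * t) *: grid_point f))
    <= 4 * (1 + (3 / c) ^+ n) * 2 ^+ m.
Proof.
move=> dn dsn s0 /andP[c0 c1] t0 yx nE uJ J0 cov.
have m1 : 1 <= 2 ^+ m :> R by rewrite exprn_ege1// ler1n.
apply: (@grid_mean_le R n _ J (fun i => i.1) cen rad
  (fun i => `|cen i - x| < 2 * t + rad i) G y N s delta) => //.
- lra.
- by move=> i /J0[].
- move=> f i iJ /(le_lt_trans (normr_le_enorm _)) zi.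
  have -> : cen i - x = - (y + (c * t) *: grid_point f - cen i)
                        + ((y - x) + (c * t) *: grid_point f).
    by apply/rowP => l; rewrite !mxE; ring.
  apply: le_lt_trans (ler_normD _ _) _; rewrite normrN addrC ler_ltD//.
  apply: le_trans (ler_normD _ _) _; rewrite normrZ ger0_norm ?mulr_ge0 ?(ltW c0) ?(ltW t0)//.
  suff : c * t * `|@grid_point R n N.+1 f| <= t by lra.
  by rewrite -[leRHS]mul1r -[leRHS]mulr1 !ler_pM// ?mulr_ge0 ?(ltW c0) ?(ltW t0)//;
    exact: norm_grid_point_le.
rewrite leNgt; apply/negP => sumlt; apply: nE.
pose P i := (`|cen i - x| < 2 * t + rad i) && (2 ^+ m <= 2 ^+ i.1 :> R).
have [[i [iJ Pi xi]]|far] := pselect (exists i, [/\ i \in J, P i & `|cen i - x| < 3 * rad i]).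
  have [Di ri _] := J0 _ iJ; move: Pi => /andP[_ mi].
  exists (rad i), [:: i]; split => //.
    move=> j; rewrite inE => /eqP ->; split => //; last by lra.
    by move: mi; rewrite ler_eXn2l// ltr1n.
  rewrite big_seq1 ler_wpM2r ?powR_ge0//.
  by apply: ge0_ler_powR => //; rewrite ?nnegrE ?exprn_ge0// ltW.
exists t, [seq i <- J | P i]; split => //; first exact: filter_uniq.
  move=> i; rewrite mem_filter => /andP[Pi iJ]; have [Di ri _] := J0 _ iJ.
  have /andP[xi mi] := Pi; split => //; first by move: mi; rewrite ler_eXn2l// ltr1n.
  by have [xi3|] := ltP `|cen i - x| (3 * rad i); [case: far; exists i|lra].
by rewrite big_filter ltW.
Qed.

(** Here [lam] is taken proportional to [t^(-delta/p)], so that the total mass [tot] is at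
    most [lam^p t^delta]; the summand [beta^(delta/p)] keeps [lam >= 1] on [t <= beta]. *)
Lemma grid_mean_le_decay (delta p c t beta tot : R) (N : nat) (J : seq (nat * nat))
    (y : 'rV[R]_n) (G : 'rV[R]_n -> R) :
  0 < delta <= n%:R -> delta <= p * n%:R -> 0 < p -> 0 < c -> 0 < t <= beta -> 0 < tot ->
  \sum_(i <- J) (2 ^+ i.1) `^ p * rad i `^ delta <= tot ->
  {in J, forall i, 0 < rad i /\ c * t / rad i <= N.+1%:R} ->
  (forall f : {ffun 'I_n -> 'I_N.+1},
     G (y + (c * t) *: grid_point f) < 2 \/
     exists i, [/\ i \in J, enorm (y + (c * t) *: grid_point f - cen i) < rad i &
        G (y + (c * t) *: grid_point f) < 4 * 2 ^+ i.1]) ->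
  grid_mean (fun f : {ffun 'I_n -> 'I_N.+1} => G (y + (c * t) *: grid_point f))
    <= 4 * (1 + (3 / c) ^+ n) * (tot `^ p^-1 + beta `^ (delta / p)) * t `^ (- (delta / p)).
Proof.
move=> dn dpn p0 c0 /andP[t0 tb] tot0 sJ J0 cov; set K := tot `^ _ + _.
have b0 : 0 < beta by lra.
have pn0 : p != 0 by rewrite gt_eqF.
have K1 : tot `^ p^-1 <= K by rewrite lerDl powR_ge0.
have K2 : beta `^ (delta / p) <= K by rewrite lerDr powR_ge0.
have K0 : 0 < K by apply: lt_le_trans K1; rewrite powR_gt0.
have dp0 : 0 <= delta / p by case/andP: dn => d0 _; rewrite divr_ge0// ltW.
rewrite -mulrA.
apply: (@grid_mean_le R n _ J (fun i => i.1) cen rad predT G y N p delta) => //.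
- suff : 1 <= K * t `^ (- (delta / p)) by lra.
  rewrite powRN ler_pdivlMr ?powR_gt0// mul1r; apply: le_trans K2.
  by apply: ge0_ler_powR => //; rewrite nnegrE ltW.
- have -> : (K * t `^ (- (delta / p))) `^ p * t `^ delta = K `^ p.
    rewrite powRM ?powR_ge0 ?(ltW K0)// -powRrM -mulrA -powRD; last first.
      by apply/implyP => _; rewrite gt_eqF.
    by rewrite mulNr divfK// addrC subrr powRr0 mulr1.
  have totE : tot = (tot `^ p^-1) `^ p by rewrite -powRrM mulVf// powRr1// ltW.
  apply: (@le_trans _ _ tot); last first.
    by rewrite {1}totE; apply: ge0_ler_powR => //; rewrite ?nnegrE ?powR_ge0// ltW.
  apply: le_trans sJ; rewrite big_mkcond/=; apply: ler_sum => i _.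
  by case: ifP => // _; rewrite mulr_ge0 ?powR_ge0.
Qed.

End Pointwise.

(** * Mean oscillation along a curve *)

Section EndOscillation.
Context {R : realType} {n : nat}.

Lemma is_derive_approx (phi : R -> R) (t l e : R) : is_derive t 1 phi l -> 0 < e ->
  exists2 d, 0 < d & forall s, `|s - t| < d ->
    `|phi s - phi t - l * (s - t)| <= e * `|s - t|.
Proof.
move=> dphi e0; have dif : differentiable phi t by apply/derivable1_diffP.
have /eqaddoP/(_ _ e0) := diff_locally dif.
move=> /nbhs_ballP[d d0 od]; exists d => // s std.
have := od (s - t); rewrite -ball_normE/= sub0r normrN => /(_ std).
rewrite !fctE/= subrK opprD addrA.
suff -> : 'd phi t (s - t) = l * (s - t) by [].
have -> : l = 'd phi t 1 by rewrite -deriveE// derive_val.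
by rewrite -[in LHS](mulr1 (s - t)) -/((s - t) *: (1 : R)) linearZ/= mulrC.
Qed.

(** The region swept when the grid is replaced by the full cube: a finite cover of it
    serves every grid. *)
Lemma tube_compact (gam : R -> 'rV[R]_n) (c L : R) :
  (forall s t, `|gam s - gam t| <= `|s - t|) ->
  compact [set gam q.1 + (c * q.1) *: q.2 |
    q in `[0, L]%classic `*` [set w : 'rV[R]_n | forall i, `[0, 1]%classic (w ord0 i)]].
Proof.
move=> lip; apply: continuous_compact; last first.
  apply: compact_setX; first exact: segment_compact.
  by apply: (@rV_compact R n (fun=> `[0, 1]%classic)) => _; exact: segment_compact.
have cgam : continuous gam.
  move=> t; apply/cvgrPdist_lt => e e0; apply/nbhs_ballP; exists e => //= s.
  by rewrite /=; exact: le_lt_trans.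
apply: continuous_subspaceT => -[t w].
apply: (@continuousD R (matrix R 1 n) (R * 'rV[R]_n)%type (fun q => gam q.1) (fun q => (c * q.1) *: q.2)).
  by apply: continuous_comp; [exact: cvg_fst|exact: cgam].
apply: continuousZ.
  by apply: continuousM; [exact: cst_continuous|exact: cvg_fst].
exact: cvg_snd.
Qed.

Context (D : set (nat * nat)) (cen : nat * nat -> 'rV[R]_n) (rad : nat * nat -> R).

(** Integration of the two speed bounds: the constant one up to time
    [r = 2^(-m p / delta)], the decaying one from [r] to [L].  At [r] both contribute
    the same power [2^(m (1 - p / delta))], and the decaying one is integrable at
    infinity because [delta / p > 1]. *)
Lemma tube_end_mean_le (Omega : set 'rV[R]_n) u (sg c L beta delta p s tot : R)
    (gam : R -> 'rV[R]_n) (m : nat) :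
  0 < delta <= n%:R -> delta <= p * n%:R -> 0 < p < delta ->
  delta <= s * n%:R -> 0 < s ->
  0 < c <= 1 -> 0 <= L <= beta -> 0 < tot -> 0 < sg ->
  open Omega -> (forall z, Omega z -> differentiable u z) ->
  {in Omega, continuous (fun z => enorm (gradient u z) / sg)} ->
  (forall i, D i -> 0 < rad i) ->
  (forall S, uniq S -> {in S, forall i, D i} ->
     \sum_(i <- S) (2 ^+ i.1) `^ p * rad i `^ delta <= tot) ->
  (forall k z, Omega z -> 2 ^+ k < enorm (gradient u z) / sg ->
     exists j, D (k, j) /\ enorm (z - cen (k, j)) < rad (k, j)) ->
  (forall s t, `|gam s - gam t| <= `|s - t|) ->
  (forall t (w : 'rV[R]_n), 0 <= t <= L -> (forall i, 0 <= w ord0 i <= 1) ->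
     Omega (gam t + (c * t) *: w)) ->
  ~ dense_set D cen rad delta s m (gam 0) ->
  exists N0, forall N, (N0 <= N)%N ->
    grid_mean (fun f : {ffun 'I_n -> 'I_N.+1} => `|u (tube_point gam c L f) - u (gam 0)|)
     <= 2 * n%:R * sg * (4 * (1 + (3 / c) ^+ n))
        * (1 + (tot `^ p^-1 + beta `^ (delta / p)) / (delta / p - 1))
        * (2 ^+ m) `^ (1 - p / delta).
Proof.
move=> dn dpn /andP[p0 pd] dsn s0 c01 /andP[L0 Lb] tot0 sg0 oO du cG rad0 sumC cov lip tub nE.
set G := fun z => enorm (gradient u z) / sg in cG cov.
have /andP[c0 c1] := c01.
have [J [uJ JD Jcov]] : exists J : seq (nat * nat), [/\ uniq J, {in J, forall i, D i} &
    forall t (w : 'rV[R]_n), 0 <= t <= L -> (forall i, 0 <= w ord0 i <= 1) ->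
      G (gam t + (c * t) *: w) < 2 \/ exists i, [/\ i \in J,
        enorm (gam t + (c * t) *: w - cen i) < rad i & G (gam t + (c * t) *: w) < 4 * 2 ^+ i.1]].
  have [|J [uJ JD Jcov]] := level_cover_finite oO cG (tube_compact (c := c) (L := L) lip) _ cov.
    move=> _ [[t w] [/= tL w01] <-]; apply: tub; first by rewrite in_itv in tL.
    by move=> i; have := w01 i; rewrite /= in_itv.
  exists J; split => // t w tL w01; apply: Jcov; exists (t, w) => //=.
(* A mesh fine enough for every ball of [J] at every time up to [L]. *)
pose S := \sum_(i <- J) c * L / rad i.
have SJ i : i \in J -> c * L / rad i <= S.
  move=> iJ; rewrite /S (big_rem i)//= lerDl big_seq sumr_ge0// => j /mem_rem /JD/rad0 rj.
  by rewrite divr_ge0 ?mulr_ge0// ltW.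
have S0 : 0 <= S.
  by rewrite /S big_seq sumr_ge0// => j /JD/rad0 rj; rewrite divr_ge0 ?mulr_ge0// ltW.
exists (Num.bound S) => N SN.
have J0 t : 0 <= t <= L -> {in J, forall i, [/\ D i, 0 < rad i & c * t / rad i <= N.+1%:R]}.
  move=> /andP[t0 tL] i iJ; have Di := JD _ iJ; have ri := rad0 _ Di; split => //.
  apply: (@le_trans _ _ S).
    by apply: le_trans (SJ _ iJ); rewrite ler_pM2r ?invr_gt0// ler_wpM2l// ltW.
  apply: (le_trans (ltW (archi_boundP S0))); rewrite ler_nat.
  exact: leqW.
have grid01 (f : {ffun 'I_n -> 'I_N.+1}) i : 0 <= @grid_point R n _ f ord0 i <= 1.
  rewrite mxE divr_ge0//= ler_pdivrMr// mul1r ler_nat ltnW//.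
have tcov t : 0 <= t <= L -> forall f : {ffun 'I_n -> 'I_N.+1},
     G (gam t + (c * t) *: grid_point f) < 2 \/
     exists i, [/\ i \in J, enorm (gam t + (c * t) *: grid_point f - cen i) < rad i &
        G (gam t + (c * t) *: grid_point f) < 4 * 2 ^+ i.1].
  by move=> tL f; exact: Jcov.
pose g t := grid_mean (fun f : {ffun 'I_n -> 'I_N.+1} =>
          enorm (gradient u (tube_point gam c t f))).
have gE t : g t = sg * grid_mean (fun f : {ffun 'I_n -> 'I_N.+1} => G (gam t + (c * t) *: grid_point f)).
  rewrite -grid_meanZ /g; congr grid_mean; apply/funext => f.
  by rewrite /G /tube_point [RHS]mulrC divfK// gt_eqF.
set M0 := 4 * (1 + (3 / c) ^+ n); set K := tot `^ p^-1 + beta `^ (delta / p).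
have M00 : 0 < M0 by rewrite mulr_gt0// ltr_pwDl// exprn_ge0// divr_ge0// ltW.
have K0 : 0 < K by rewrite ltr_pwDl ?powR_ge0// powR_gt0.
have g1 t : 0 < t <= L -> g t <= sg * (M0 * 2 ^+ m).
  move=> /andP[t0 tL]; have t0L : 0 <= t <= L by rewrite ltW.
  rewrite gE ler_wpM2l// ?(ltW sg0)//.
  apply: (@grid_mean_le_off_dense_set R n D cen rad delta s c t m N J (gam 0)) => //.
  - by apply: le_trans (lip _ _) _; rewrite subr0 ger0_norm// ltW.
  - exact: J0.
  - exact: tcov.
have g2 t : 0 < t <= L -> g t <= sg * (M0 * K * t `^ (- (delta / p))).
  move=> /andP[t0 tL]; have t0L : 0 <= t <= L by rewrite ltW.
  rewrite gE ler_wpM2l// ?(ltW sg0)//.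
  apply: (@grid_mean_le_decay R n cen rad delta p c t beta tot N J) => //.
  - by rewrite t0 (le_trans tL).
  - exact: sumC.
  - by move=> i /(J0 _ t0L)[].
  - exact: tcov.
have c01' : 0 <= c <= 1 by rewrite ltW.
have gtub t : 0 <= t <= L -> forall f : {ffun 'I_n -> 'I_N.+1}, Omega (tube_point gam c t f).
  by move=> tL f; apply: tub.
pose mu t := grid_mean (fun f : {ffun 'I_n -> 'I_N.+1} => `|u (tube_point gam c t f) - u (gam 0)|).
have mu0 : mu 0 = 0.
  rewrite /mu /grid_mean big1 ?mul0r// => f _.
  by rewrite /tube_point mulr0 scale0r addr0 subrr normr0.
have n20 : 0 <= 2 * n%:R :> R by rewrite mulr_ge0.
pose A := 2 * n%:R * (sg * (M0 * 2 ^+ m)).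
have W0 : 0 < 2 ^+ m :> R by rewrite exprn_gt0.
have A0 : 0 <= A := mulr_ge0 n20 (mulr_ge0 (ltW sg0) (mulr_ge0 (ltW M00) (ltW W0))).
have step1 b : 0 <= b <= L -> mu b <= A * b.
  move=> /andP[b0 bL].
  have := @tube_mean_variation R n Omega u gam c N (fun t => A * t) 0 b (u (gam 0)) du lip c01' b0.
  rewrite -/(mu b) -/(mu 0) mu0 mulr0 subr0 add0r; apply.
  - by move=> t /andP[t0 tb]; apply: gtub; rewrite t0 (le_trans tb).
  - move=> t _; apply: continuousM; first exact: cst_continuous.
    by move=> B.
  - move=> t /andP[t0 tb] e e0; exists 1 => // r /andP[tr _].
    rewrite -mulrBr; apply: (@le_trans _ _ (A * (r - t))).
      by rewrite ler_wpM2r ?subr_ge0// ler_wpM2l// g1// t0 ltW// (lt_le_trans tb).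
    by rewrite lerDl mulr_ge0 ?subr_ge0// ltW.
pose a := delta / p.
have a1 : 1 < a by rewrite ltr_pdivlMr// mul1r.
pose B := 2 * n%:R * (sg * (M0 * K)).
have B0 : 0 <= B := mulr_ge0 n20 (mulr_ge0 (ltW sg0) (mulr_ge0 (ltW M00) (ltW K0))).
pose phi (t : R) : R := - (B / (a - 1)) * t `^ (1 - a).
have step2 r : 0 < r <= L -> mu L <= mu r + B / (a - 1) * r `^ (1 - a).
  move=> /andP[r0 rL].
  have dphi (t : R) : 0 < t -> is_derive t (1 : R) phi (B * t `^ (- a)).
    move=> t0; have := is_derive1_powR (1 - a) t0 => d1.
    have -> : B * t `^ (- a) = - (B / (a - 1)) *: ((1 - a) * t `^ (1 - a - 1)).
      rewrite /GRing.scale/= mulrA; congr (_ * _ `^ _); last by lra.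
      by field; lra.
    exact: is_deriveZ.
  apply: (@le_trans _ _ (mu r + (phi L - phi r))); last first.
    have : 0 <= B / (a - 1) * L `^ (1 - a).
      by rewrite mulr_ge0 ?powR_ge0// divr_ge0// subr_ge0 ltW.
    by rewrite /phi; lra.
  apply: (@tube_mean_variation R n Omega u gam c N phi r L (u (gam 0)) du lip c01') => //.
  - by move=> t /andP[t0 tb]; apply: gtub; rewrite tb (le_trans (ltW r0)).
  - move=> t /andP[t0 tb]; apply: differentiable_continuous.
    by apply/derivable1_diffP; case: (dphi t (lt_le_trans r0 t0)).
  - move=> t /andP[rt tL] e e0; have t0 := lt_trans r0 rt.
    have [d d0 dH] := is_derive_approx (dphi t t0) e0; exists d => // x /andP[tx xd].
    have := dH x; have -> : `|x - t| = x - t by rewrite ger0_norm// subr_ge0.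
    rewrite ltrBlDl xd => /(_ isT); rewrite ler_norml => /andP[h1 _].
    apply: (@le_trans _ _ (B * t `^ (- a) * (x - t))); last by clear -h1; lra.
    rewrite ler_wpM2r ?subr_ge0//.
    have -> : B * t `^ (- a) = 2 * n%:R * (sg * (M0 * K * t `^ (- (delta / p)))).
      by rewrite /B /a; ring.
    by rewrite ler_wpM2l// g2// t0 ltW.
set W := 2 ^+ m : R in A A0 g1 W0 step1 *.
pose r := W `^ (- (p / delta)).
have r0 : 0 < r by rewrite powR_gt0.
have d0 : 0 < delta by case/andP: dn.
have rA : A * r = B / K * W `^ (1 - p / delta).
  have -> : W `^ (1 - p / delta) = W * r.
    by rewrite powRD ?powRr1 ?(ltW W0)//; apply/implyP => _; rewrite gt_eqF.
  by rewrite /A /B -/W; field; rewrite gt_eqF.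
have rB : r `^ (1 - a) = W `^ (1 - p / delta).
  rewrite /r -powRrM; congr (_ `^ _); rewrite /a; field.
  by rewrite !gt_eqF.
have -> : 2 * n%:R * sg * M0 * (1 + K / (delta / p - 1)) * W `^ (1 - p / delta)
    = B / K * W `^ (1 - p / delta) + B / (a - 1) * W `^ (1 - p / delta).
  by rewrite /B -/a; field; rewrite !gt_eqF ?subr_gt0.
rewrite -/(mu L) -rA.
have Bp : 0 <= B / (a - 1) * W `^ (1 - p / delta).
  by rewrite mulr_ge0 ?powR_ge0// divr_ge0// subr_ge0 ltW.
have [Lr|rL] := leP L r.
  apply: (@le_trans _ _ (A * L)); first by apply: step1; rewrite L0 lexx.
  by rewrite -[leLHS]addr0 lerD// ler_wpM2l.
apply: le_trans (step2 r _) _; first by rewrite r0 ltW.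
by rewrite rB lerD2r; apply: step1; rewrite !ltW.
Qed.

End EndOscillation.

(** * Content of the exceptional sets *)

Section Vitali.
Context {R : realType} {V : normedModType R}.

(** Vitali's selection by Zorn's lemma, among the disjoint subfamilies with the property
    that a ball meeting one of their members meets one of at least half its radius.  To
    a maximal one that some ball misses, a missed ball of nearly largest radius could
    be added. *)
Lemma vitali_subfamily (E : set V) (rho : V -> R) (M : R) :
  (forall x, E x -> 0 < rho x <= M) ->
  exists A : set V, [/\ A `<=` E,
    forall x y, A x -> A y -> x != y -> rho x + rho y <= `|x - y| &
    forall x, E x -> exists y, [/\ A y, `|x - y| < rho x + rho y & rho x <= 2 * rho y]].
Proof.
move=> rhoM.
pose meets x (A : set V) := exists2 y, A y & `|x - y| < rho x + rho y.
pose P (A : set V) := [/\ A `<=` E,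
  forall x y, A x -> A y -> x != y -> rho x + rho y <= `|x - y| &
  forall x, E x -> meets x A ->
    exists y, [/\ A y, `|x - y| < rho x + rho y & rho x <= 2 * rho y]].
have [|A [[AE Adis Agreedy] Amax]] := @Zorn_bigcup V P.
  move=> F FP totF; split.
  - by move=> x [X FX Xx]; case: (FP _ FX) => + _ _; exact.
  - move=> x y [X FX Xx] [Y FY Yy] xy; have [XY|YX] := totF _ _ FX FY.
      by case: (FP _ FY) => _ + _; apply => //; exact: XY.
    by case: (FP _ FX) => _ + _; apply => //; exact: YX.
  - move=> x Ex [y [Y FY Yy] xy].
    have [_ _ /(_ x Ex)[|z [Yz xz rz]]] := FP _ FY; first by exists y.
    by exists z; split => //; exists Y.
exists A; split => // x Ex; apply: (Agreedy) => //; apply: contrapT => nx.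
pose S := rho @` [set z | E z /\ ~ meets z A].
have supS : has_sup S.
  split; first by exists (rho x), x.
  by exists M => _ [z [Ez _] <-]; case/andP: (rhoM _ Ez).
have supx : 0 < sup S.
  apply: (@lt_le_trans _ _ (rho x)); first by case/andP: (rhoM _ Ex).
  by apply: (sup_upper_bound supS); exists x.
have [|_ [z [Ez nz] <-] zsup] := @sup_adherent _ S (sup S / 2) _ supS.
  by rewrite divr_gt0.
have nzA : ~ A z.
  move=> Az; apply: nz; exists z => //; rewrite subrr normr0.
  by case/andP: (rhoM _ Ez) => z0 _; rewrite addr_gt0.
apply: (Amax (A `|` [set z])).
  by split; [exact: subsetUl|move=> /(_ z)/= Az; apply: nzA; apply: Az; right].
split.
- by move=> w [/AE|->].
- have far w : A w -> rho z + rho w <= `|z - w|.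
    by move=> Aw; rewrite leNgt; apply/negP => zw; apply: nz; exists w.
  move=> w w' [Aw|->] [Aw'|->]; first exact: Adis.
  + by move=> _; rewrite addrC distrC; exact: far.
  + by move=> _; exact: far.
  + by rewrite eqxx.
- move=> w Ew [y Ay wy]; have [mw|nw] := pselect (meets w A).
    by have [v [Av wv rv]] := Agreedy _ Ew mw; exists v; split => //; left.
  case: Ay wy => [Ay wy|-> wz]; first by case: nw; exists y.
  exists z; split => //; first by right.
  have : rho w <= sup S by apply: (sup_upper_bound supS); exists w.
  by move: zsup; lra.
Qed.

End Vitali.

Section DenseSetContent.
Context {R : realType} {n : nat}.
Context (D : set (nat * nat)) (cen : nat * nat -> 'rV[R]_n) (rad : nat * nat -> R).

(** The balls of radius [4 t x] selected by [vitali_subfamily] are disjoint, so no index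
    serves two of them and their masses add up to at most [T]; enlarged threefold they
    cover the exceptional set.  The factor [n] passes from the supremum norm, in which
    the selection is made, to the Euclidean norm.  The covering is numbered by the first
    index of each selected ball, hence is countable. *)
Lemma dense_set_content (delta s T : R) (m : nat) : (0 < n)%N -> 0 < delta -> 0 <= T ->
  (forall S, uniq S -> {in S, forall i : nat * nat, D i /\ (m <= i.1)%N} ->
     \sum_(i <- S) (2 ^+ i.1) `^ s * rad i `^ delta <= T) ->
  (hausdorff_content delta (dense_set D cen rad delta s m)
     <= ((12 * n%:R) `^ delta * (T / (2 ^+ m) `^ s))%:E)%E.
Proof.
move=> n0 d0 T0 sumT; set E := dense_set _ _ _ _ _ _.
pose w (i : nat * nat) := (2 ^+ i.1) `^ s * rad i `^ delta.
have W0 : 0 < (2 ^+ m) `^ s :> R by rewrite powR_gt0// exprn_gt0.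
have /choice[q qE] : forall x, exists q : R * seq (nat * nat), E x ->
    [/\ 0 < q.1, uniq q.2,
     {in q.2, forall i : nat * nat, [/\ D i, (m <= i.1)%N & `|cen i - x| < 4 * q.1]} &
     (2 ^+ m) `^ s * q.1 `^ delta <= \sum_(i <- q.2) w i].
  move=> x; have [[t [S tS]]|nE] := pselect (E x); first by exists (t, S).
  by exists (0, [::]).
pose t x := (q x).1; pose S x := (q x).2.
have tE x : E x -> t x `^ delta <= T / (2 ^+ m) `^ s.
  move=> /qE[t0 uS SD le]; rewrite ler_pdivlMr// mulrC; apply: (le_trans le).
  by apply: sumT => // i /SD[].
have [|A [AE Adis Acov]] := @vitali_subfamily R 'rV[R]_n E (fun x => 4 * t x)
    (4 * (T / (2 ^+ m) `^ s) `^ delta^-1).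
  move=> x Ex; have [t0 _ _ _] := qE _ Ex; rewrite mulr_gt0//= ler_pM2l//.
  have -> : t x = (t x `^ delta) `^ delta^-1.
    by rewrite -powRrM mulfV ?gt_eqF// powRr1// ltW.
  by apply: ge0_ler_powR; rewrite ?invr_ge0 ?nnegrE ?powR_ge0 ?(ltW d0) ?tE// divr_ge0// ltW.
have same x y i : A x -> A y -> i \in S x -> i \in S y -> x = y.
  move=> Ax Ay ix iy; apply/eqP; apply: contraT => xy.
  have [_ _ /(_ i ix)[_ _ hx] _] := qE _ (AE _ Ax).
  have [_ _ /(_ i iy)[_ _ hy] _] := qE _ (AE _ Ay).
  have := Adis _ _ Ax Ay xy; rewrite leNgt => /negP[].
  have -> : x - y = (cen i - y) - (cen i - x) by rewrite opprB addrCA addrAC subrr add0r addrC.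
  by apply: le_lt_trans (ler_normB _ _) _; rewrite addrC ltrD.
pose h x := head (0, 0)%N (S x).
have hS x : A x -> h x \in S x.
  move=> Ax; have [t0 _ _] := qE _ (AE _ Ax); rewrite /h -/(S x).
  case: (S x) => [|i l _]; last by rewrite mem_head.
  by rewrite big_nil leNgt mulr_gt0// powR_gt0.
pose f x := pickle (h x).
have finj : set_inj A f.
  move=> x y; rewrite !inE => Ax Ay /(pcan_inj pickleK) hxy.
  by apply: (same _ _ (h x)) => //; [exact: hS|rewrite hxy; exact: hS].
pose g j := xget 0 [set x | A x /\ f x = j].
have gf x : A x -> g (f x) = x.
  move=> Ax; rewrite /g; case: xgetP => [y _ [Ay fyx]|/(_ x)]; last by case.
  by apply: finj; rewrite ?inE.
apply: (@le_trans _ _ (\esum_(j in f @` A) ((12 * n%:R * t (g j)) `^ delta)%:E)%E).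
  apply: ereal_inf_lbound; exists (f @` A), g, (fun j => 12 * n%:R * t (g j)); split => //.
    move=> _ [x Ax <-]; rewrite gf//; have [t0 _ _ _] := qE _ (AE _ Ax).
    by rewrite !mulr_gt0// ltr0n.
  move=> x Ex; have [y [Ay xy ty]] := Acov _ Ex.
  exists (f y); first by exists y.
  rewrite /eball/= gf//; apply: le_lt_trans (enorm_le_normr _) _.
  rewrite [12 * _]mulrC -mulrA ltr_pM2l ?ltr0n//; lra.
rewrite esum_image//; apply: ge_ereal_sup => _ [X [finX XA] <-].
have -> : (\sum_(x \in X) ((12 * n%:R * t (g (f x))) `^ delta)%:E)%E =
   ((12 * n%:R) `^ delta * \sum_(x \in X) t x `^ delta)%:E.
  rewrite !fsbig_finite//= sumEFin mulr_sumr; congr (_%:E).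
  rewrite big_seq [RHS]big_seq; apply: eq_bigr => x; rewrite in_fset_set// inE => /XA Ax.
  rewrite gf// powRM// ?mulr_ge0//.
  by have [t0 _ _ _] := qE _ (AE _ Ax); exact: ltW.
rewrite lee_fin ler_wpM2l ?powR_ge0// ler_pdivlMr// fsbig_finite//=.
have : {in finmap.enum_fset (fset_set X), forall x, A x}.
  by move=> x; rewrite in_fset_set// inE => /XA.
have : uniq (finmap.enum_fset (fset_set X)) by exact: finmap.fset_uniq.
move: (finmap.enum_fset (fset_set X)) => xs uxs xsA.
have [S' [uS' SS' le]] : exists S', [/\ uniq S',
    forall i, i \in S' -> exists2 x, x \in xs & i \in S x &
    (\sum_(x <- xs) t x `^ delta) * (2 ^+ m) `^ s <= \sum_(i <- S') w i].
  elim: xs uxs xsA => [_ _|x xs IH /= /andP[xxs uxs] xsA].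
    by exists [::]; split => //; rewrite !big_nil mul0r.
  have [|S' [uS' SS' le]] := IH uxs.
    by move=> y yxs; apply: xsA; rewrite inE yxs orbT.
  have Ax : A x by apply: xsA; rewrite inE eqxx.
  have [t0 uSx SxD lex] := qE _ (AE _ Ax).
  exists (S x ++ S'); split.
  - rewrite cat_uniq uSx uS' andbT; apply/hasPn => i /SS'[y yxs iy].
    apply/negP => /= ix; move: xxs; suff -> : x = y by rewrite yxs.
    by apply: (same _ _ i) => //; apply: xsA; rewrite inE yxs orbT.
  - move=> i; rewrite mem_cat => /orP[ix|/SS'[y yxs iy]]; first by exists x; rewrite ?inE ?eqxx.
    by exists y => //; rewrite inE yxs orbT.
  - by rewrite big_cons big_cat/= mulrDl lerD// mulrC.
apply: (le_trans le); apply: sumT => // i /SS'[x /xsA Ax iSx].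
by have [_ _ /(_ i iSx)[]] := qE _ (AE _ Ax).
Qed.

End DenseSetContent.

(** * John curves *)

Section JohnOscillation.
Context {R : realType} {n : nat}.
Implicit Types (Omega : set 'rV[R]_n) (g : R -> 'rV[R]_n).

Lemma enorm0 : enorm (0 : 'rV[R]_n) = 0.
Proof. by rewrite /enorm big1 ?sqrtr0// => i _; rewrite mxE expr0n. Qed.

(** Adding the vertex [t] to a partition from 0 to [s] lengthens the inscribed polygon by
    the chord from [g s] to [g t], and the curve has length [s] up to [s], [t] up to [t]. *)
Lemma arc_length_lipschitz (l s t : R) g : arc_length_curve l g ->
  0 <= s -> s <= t -> t <= l -> enorm (g t - g s) <= t - s.
Proof.
move=> [_ len] s0; rewrite le_eqVlt => /predU1P[<- _|st tl].
  by rewrite !subrr enorm0.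
have := len s; rewrite s0 (le_trans (ltW st) tl) => /(_ isT) lens.
have := len t; rewrite (le_trans s0 (ltW st)) tl => /(_ isT) lent.
rewrite lerBrDr -lerBrDl -lee_fin -lens; apply: ge_ereal_sup => _ [P [pP /eqP lP] <-].
rewrite EFinB leeBrDr// -EFinD -lent.
apply: ereal_sup_ubound; exists (rcons P t).
  by split; rewrite ?last_rcons// rcons_path pP lP.
rewrite size_rcons big_nat_recr//=; congr (_ + _)%:E.
  apply: eq_big_nat => k /= kP; rewrite -rcons_cons !nth_rcons/= kP ltnS (ltnW kP).
  congr (enorm (g _ - g _)); first exact: set_nth_default.
  by apply: set_nth_default; rewrite /= ltnS ltnW.
rewrite nth_rcons ltnn eqxx -rcons_cons nth_rcons/= ltnSn.
by rewrite (set_nth_default 0) /= ?ltnSn// -[X in nth _ _ X]/((size (0 :: P)).-1) nth_last/= lP.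
Qed.

(** If no point of a segment is a boundary point, its trace on [Omega] is both open and
    closed in it, so the connected segment lies in [Omega]. *)
Lemma segment_stays_inside Omega (z w : 'rV[R]_n) (d : R) :
  open Omega -> Omega z -> (d%:E <= edist_set z (boundary Omega))%E ->
  enorm (w - z) < d -> Omega w.
Proof.
move=> oO Oz dz wz.
pose h (t : R) : 'rV[R]_n := z + t *: (w - z).
have ch : {within `[0, 1], continuous h}.
  apply: continuous_subspaceT => t.
  apply: (@continuousD R 'rV[R]_n R (cst z) (fun t => t *: (w - z))); first exact: cst_continuous.
  by apply: (@continuousZ R 'rV[R]_n R id (cst (w - z))); [move=> A|exact: cst_continuous].
have seg := connected_continuous_connected (@segment_connected R 0 1) ch.
have nb t : 0 <= t <= 1 -> ~ boundary Omega (h t).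
  move=> /andP[t0 t1] bt; move: dz; rewrite leNgt => /negP; apply.
  apply: (@le_lt_trans _ _ (enorm (z - h t))%:E).
    by apply: ereal_inf_lbound; exists (h t).
  rewrite lte_fin; apply: le_lt_trans wz.
  rewrite /h opprD addrA subrr add0r /enorm ler_wsqrtr// ler_sum// => i _.
  rewrite !mxE sqrrN exprMn ler_piMl ?sqr_ge0//.
  by rewrite -(expr1n _ 2) lerXn2r ?nnegrE.
have OE : (h @` `[0, 1]) `&` Omega = (h @` `[0, 1]) `&` closure Omega.
  apply/seteqP; split => x [[t t01 <-] Ox]; split; try by exists t.
    exact: subset_closure.
  apply: contrapT => nO; apply: (nb t); first by move: t01; rewrite /= in_itv.
  by split => // /interior_subset.
have : (h @` `[0, 1]) `&` Omega = h @` `[0, 1].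
  apply: seg.
  - by exists z; split => //; exists 0; rewrite /= ?in_itv/= ?lexx ?ler01// /h scale0r addr0.
  - by exists Omega.
  - by exists (closure Omega) => //; exact: closed_closure.
move=> E; have : (h @` `[0, 1]) w.
  by exists 1; rewrite /= ?in_itv/= ?lexx ?ler01// /h scale1r addrC subrK.
by rewrite -E => -[].
Qed.

(** Extends a curve given between 0 and [l] by its end values. *)
Definition clamp (l t : R) := Num.max 0 (Num.min t l).

Lemma clamp_lipschitz l s t : `|clamp l s - clamp l t| <= `|s - t|.
Proof.
wlog st : s t / s <= t.
  move=> H; have [st|/ltW ts] := leP s t; first exact: H.
  by rewrite distrC (distrC s); exact: H.
rewrite ler_norml /clamp; have -> : `|s - t| = t - s by rewrite distrC ger0_norm ?subr_ge0.
have : 0 <= Num.min t l - Num.min s l <= t - s.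
  by case: (leP s l) => h1; case: (leP t l) => h2; lra.
move: (Num.min s l) (Num.min t l) => a b h.
by case: (leP 0 a) => h1; case: (leP 0 b) => h2; lra.
Qed.

Lemma clamp_itv l t : 0 <= l -> 0 <= clamp l t <= l.
Proof. by move=> l0; rewrite le_max lexx/= ge_max l0 ge_min lexx orbT. Qed.

Lemma clampE l t : 0 <= t <= l -> clamp l t = t.
Proof. by move=> /andP[t0 tl]; rewrite /clamp min_l// max_r. Qed.

Lemma clamp_ge l t : 0 <= l <= t -> clamp l t = l.
Proof. by move=> /andP[t0 tl]; rewrite /clamp min_r// max_r. Qed.

Lemma arc_clamp_lipschitz l g s t : 0 <= l -> arc_length_curve l g ->
  `|g (clamp l s) - g (clamp l t)| <= `|s - t|.
Proof.
move=> l0 gl; apply: le_trans (clamp_lipschitz l s t).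
have /andP[s0 sl] := clamp_itv s l0; have /andP[t0 tl] := clamp_itv t l0.
move: (clamp l s) (clamp l t) s0 sl t0 tl => a b.
wlog ab : a b / a <= b.
  move=> H; have [ab|/ltW ba] := leP a b; first exact: H.
  by move=> *; rewrite distrC (distrC a); exact: H.
move=> a0 al b0 bl; rewrite distrC (distrC a) ger0_norm ?subr_ge0//.
by apply: le_trans (normr_le_enorm _) _; exact: arc_length_lipschitz gl _ _ _.
Qed.

End JohnOscillation.

(** * Oscillation in a John domain *)

Section JohnOscillationBound.
Context {R : realType} {n : nat}.
Context (D : set (nat * nat)) (cen : nat * nat -> 'rV[R]_n) (rad : nat * nat -> R).

Definition osc_const (c beta delta p tot : R) : R :=
  2 * n%:R * (4 * (1 + (3 / c) ^+ n))
  * (1 + (tot `^ p^-1 + beta `^ (delta / p)) / (delta / p - 1)).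

Lemma osc_const_gt0 (c beta delta p tot : R) :
  (0 < n)%N -> 0 <= c -> 0 < p < delta -> 0 < osc_const c beta delta p tot.
Proof.
move=> n0 c0 /andP[p0 pd]; rewrite /osc_const mulr_gt0// ?mulr_gt0// ?ltr_pwDl// ?ltr0n//.
- by rewrite exprn_ge0// divr_ge0.
- apply: divr_ge0; first by rewrite addr_ge0 ?powR_ge0.
  by rewrite subr_ge0 ler_pdivlMr// mul1r ltW.
Qed.

(** Both John curves are run up to the longer of the two lengths, the shorter one resting
    at the centre; the John condition of the longer curve at its end keeps the
    perturbations of the resting curve inside.  For equal grid parameters the two
    perturbed curves end at the same point. *)
Lemma john_oscillation (Omega : set 'rV[R]_n) u (sg alpha beta delta p s tot : R) (m : nat) x y :
  0 < delta <= n%:R -> delta <= p * n%:R -> 0 < p < delta ->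
  delta <= s * n%:R -> 0 < s -> 0 < tot -> 0 < sg ->
  john_domain alpha beta Omega -> C1 Omega u ->
  (forall i, D i -> 0 < rad i) ->
  (forall S, uniq S -> {in S, forall i, D i} ->
     \sum_(i <- S) (2 ^+ i.1) `^ p * rad i `^ delta <= tot) ->
  (forall k z, Omega z -> 2 ^+ k < enorm (gradient u z) / sg ->
     exists j, D (k, j) /\ enorm (z - cen (k, j)) < rad (k, j)) ->
  Omega x -> ~ dense_set D cen rad delta s m x ->
  Omega y -> ~ dense_set D cen rad delta s m y ->
  `|u x - u y| <= sg * (2 * osc_const (alpha / (2 * beta * n%:R)) beta delta p tot)
                  * (2 ^+ m) `^ (1 - p / delta).
Proof.
move=> dn dpn p0 dsn s0 tot0 sg0 [/andP[a0 ab] [oO _ _] [x0 Ox0 john]] [du cdu] rad0 sumC cov.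
move=> Ox nx Oy ny.
have b0 : 0 < beta by exact: lt_le_trans ab.
have n1 : 1 <= n%:R :> R.
  by rewrite ler1n -(ltr0n R); case/andP: dn; exact: lt_le_trans.
have n0 : 0 < n%:R :> R by exact: lt_le_trans n1.
have ab0 : 0 < alpha / beta by rewrite divr_gt0.
(* The Euclidean size of the perturbation at time [t] is at most [n c t], half of
   the distance to the boundary granted by the John condition. *)
set c := alpha / (2 * beta * n%:R).
have cE : c * n%:R = alpha / beta / 2 by rewrite /c; field; rewrite !gt_eqF.
have c0 : 0 < c by rewrite divr_gt0// !mulr_gt0.
have c1 : c <= 1.
  rewrite /c ler_pdivrMr ?mul1r ?mulr_gt0//; apply: (le_trans ab).
  by rewrite -mulrA mulrCA ler_peMr ?(ltW b0)// -natrM ler1n muln_gt0/= -(ltr0n R).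
have cG : {in Omega, continuous (fun z => enorm (gradient u z) / sg)}.
  move=> z Oz; apply: (@continuousM R 'rV[R]_n (fun z => enorm (gradient u z)) (cst sg^-1)); last exact: cst_continuous.
  apply: (@continuous_comp 'rV[R]_n 'rV[R]_n R); last exact: continuous_enorm.
  by move: cdu; rewrite continuous_open_subspace// => /(_ z Oz).
have [lx [gx [/andP[lx0 lxb] arcx gx0 gxl jx]]] := john x Ox.
have [ly [gy [/andP[ly0 lyb] arcy gy0 gyl jy]]] := john y Oy.
pose L := Num.max lx ly.
have L0 : 0 <= L by rewrite le_max lx0.
have Lb : L <= beta by rewrite ge_max lxb.
have distx0 : ((alpha / beta * L)%:E <= edist_set x0 (boundary Omega))%E.
  rewrite /L; case: (leP lx ly) => _.
    by have := (jy ly _).2; rewrite gyl ly0 lexx; exact.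
  by have := (jx lx _).2; rewrite gxl lx0 lexx; exact.
have one l g z : Omega z -> ~ dense_set D cen rad delta s m z -> 0 <= l <= L ->
    arc_length_curve l g -> g 0 = z -> g l = x0 ->
    (forall t, 0 <= t <= l -> Omega (g t) /\
       ((alpha / beta * t)%:E <= edist_set (g t) (boundary Omega))%E) ->
    exists N0, forall N, (N0 <= N)%N ->
    grid_mean (fun f : {ffun 'I_n -> 'I_N.+1} => `|u (x0 + (c * L) *: grid_point f) - u z|)
      <= sg * osc_const c beta delta p tot * (2 ^+ m) `^ (1 - p / delta).
  move=> Oz nz /andP[l0 lL] arc g0 gl jg.
  pose gam t := g (clamp l t).
  have gam0 : gam 0 = z by rewrite /gam clampE// lexx.
  have gamL : gam L = x0 by rewrite /gam clamp_ge// l0.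
  have lip a b : `|gam a - gam b| <= `|a - b| by exact: arc_clamp_lipschitz.
  have dist t : 0 <= t <= L -> Omega (gam t) /\
       ((alpha / beta * t)%:E <= edist_set (gam t) (boundary Omega))%E.
    move=> /andP[t0 tL]; rewrite /gam; have [tl|/ltW lt] := leP t l.
      by rewrite clampE ?t0//; apply: jg; rewrite t0.
    rewrite clamp_ge ?l0// gl; split => //.
    by apply: le_trans distx0; rewrite lee_fin ler_pM2l.
  have tub t (w : 'rV[R]_n) : 0 <= t <= L -> (forall i, 0 <= w ord0 i <= 1) ->
      Omega (gam t + (c * t) *: w).
    move=> tL w01; have [Og dg] := dist t tL; have /andP[t0 _] := tL.
    have [->|tn0] := eqVneq t 0; first by rewrite mulr0 scale0r addr0 gam0.
    apply: (segment_stays_inside oO Og dg); rewrite addrC addKr.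
    apply: le_lt_trans (enorm_le_normr _) _.
    have t_gt0 : 0 < t by rewrite lt_neqAle eq_sym tn0.
    have ct0 : 0 <= c * t by rewrite mulr_ge0// ltW.
    have w1 : `|w| <= 1.
      apply: normr_le_coord => // i; have /andP[w0 w1] := w01 i.
      by rewrite ger0_norm.
    rewrite normrZ (ger0_norm ct0).
    apply: (@le_lt_trans _ _ (n%:R * (c * t))).
      by rewrite ler_wpM2l ?(ltW n0)// ler_piMr.
    by rewrite mulrA (mulrC _ c) cE ltr_pM2r// ltr_pdivrMr// ltr_pMr// ltr1n.
  have [|||N0 HN0] := @tube_end_mean_le R n D cen rad Omega u sg c L beta delta p s tot gam m dn dpn p0
    dsn s0 _ _ tot0 sg0 oO du cG rad0 sumC cov lip tub.
  - by rewrite c0.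
  - by rewrite L0.
  - by rewrite gam0.
  exists N0 => N /HN0; rewrite gam0 /tube_point gamL => /le_trans; apply.
  by rewrite /osc_const le_eqVlt; apply/orP; left; apply/eqP; ring.
have [|Nx HNx] := one lx gx x Ox nx _ arcx gx0 gxl jx; first by rewrite lx0 le_max lexx.
have [|Ny HNy] := one ly gy y Oy ny _ arcy gy0 gyl jy; first by rewrite ly0 le_max lexx orbT.
pose N := maxn Nx Ny.
have hx := HNx N (leq_maxl _ _); have hy := HNy N (leq_maxr _ _).
have N0 : 0 < N.+1%:R ^+ n :> R by rewrite exprn_gt0.
have <- : grid_mean (fun f : {ffun 'I_n -> 'I_N.+1} => `|u x - u y|) = `|u x - u y|.
  by rewrite /grid_mean sumr_const card_ffun !card_ord -[_ *+ _]mulr_natr natrX mulfK ?gt_eqF.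
set Fx := (X in grid_mean X <= _) in hx; set Fy := (X in grid_mean X <= _) in hy.
apply: (@le_trans _ _ (grid_mean (fun f => Fx f + 1 * Fy f + 0))); last first.
  by rewrite grid_mean_affine; lra.
apply: grid_mean_mono => f; rewrite mul1r addr0 /Fx /Fy distrC.
have -> : u y - u x = (u (x0 + (c * L) *: grid_point f) - u x) - (u (x0 + (c * L) *: grid_point f) - u y) by ring.
exact: ler_normB.
Qed.

End JohnOscillationBound.

(** * Step functions and the Lebesgue integral on the half-line *)

Section StepIntegrals.
Context {R : realType}.
Local Notation mu := (@lebesgue_measure R).
Local Notation pos := (`]0%R, +oo[%classic : set R).

(** The integral of a nonnegative function is a supremum over the simple functions below
    it, so monotonicity holds without measurability of the distribution functions to
    which it is applied. *)
Lemma ge0_le_integral_nonmeasurable (f1 f2 : R -> \bar R) :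
  (forall t, pos t -> (0 <= f1 t)%E) -> (forall t, pos t -> (f1 t <= f2 t)%E) ->
  (\int[mu]_(t in pos) f1 t <= \int[mu]_(t in pos) f2 t)%E.
Proof.
move=> f10 f12; have f20 t : pos t -> (0 <= f2 t)%E.
  by move=> pt; exact: le_trans (f10 t pt) (f12 t pt).
rewrite !ge0_integralE//; apply: ereal_sup_le => _ [h hf <-]; exists h => //= t.
apply: le_trans (hf t) _; rewrite /patch; case: ifPn => // /[!inE]; exact: f12.
Qed.

Definition step (e node : nat -> R) (m : nat) (t : R) : \bar R :=
  ((e m)%:E * (\1_(`[node m, node m.+1[%classic) t)%:E)%E.

Lemma step_ge0 e node m t : (forall m, 0 <= e m) -> (0 <= step e node m t)%E.
Proof. by move=> e0; rewrite mule_ge0 ?lee_fin. Qed.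

Lemma measurable_step e node m : measurable_fun pos (step e node m).
Proof.
apply: measurable_funeM; apply/measurable_EFinP; apply: measurable_indic.
exact: measurable_itv.
Qed.

Lemma integral_step e node m : (forall m, 0 <= e m) -> node m <= node m.+1 ->
  (\int[mu]_(t in pos) step e node m t <= (e m * (node m.+1 - node m))%R%:E)%E /\
  ((0 < node m)%R -> \int[mu]_(t in pos) step e node m t = (e m * (node m.+1 - node m))%:E)%E.
Proof.
move=> e0 tm; have mA : measurable (`[node m, node m.+1[%classic : set R) by exact: measurable_itv.
have mP : measurable pos by exact: measurable_itv.
have lenE : mu `[node m, node m.+1[%classic = (node m.+1 - node m)%:E.
  rewrite lebesgue_measure_itv/= lte_fin; case: ltP => // h.
  by have -> : node m.+1 = node m; [apply/eqP; rewrite eq_le h|rewrite subrr].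
have -> : (\int[mu]_(t in pos) step e node m t = (e m)%:E * mu (`[node m, node m.+1[ `&` pos))%E.
  rewrite ge0_integralZl_EFin//; last first.
    by apply/measurable_EFinP; exact: measurable_indic.
  by rewrite integral_indic.
split=> [|t0].
  rewrite EFinM -lenE lee_wpmul2l ?lee_fin//; apply: le_measure; rewrite ?inE//.
  exact: measurableI.
rewrite (_ : _ `&` _ = `[node m, node m.+1[%classic) ?lenE ?EFinM//.
apply/setIidPl => t /=; rewrite !in_itv/= andbT => /andP[h _]; exact: lt_le_trans h.
Qed.

Lemma integral_le_steps (phi : R -> \bar R) (e node : nat -> R) :
  (forall t, pos t -> (0 <= phi t)%E) -> (forall m, 0 <= e m) ->
  (forall m, node m <= node m.+1) ->
  (forall t, pos t -> exists2 m, node m <= t < node m.+1 & (phi t <= (e m)%:E)%E) ->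
  (\int[mu]_(t in pos) phi t <= \sum_(0 <= m <oo) (e m * (node m.+1 - node m))%:E)%E.
Proof.
move=> phi0 e0 tm le.
apply: (@le_trans _ _ (\int[mu]_(t in pos) \sum_(0 <= m <oo) step e node m t)%E).
  apply: ge0_le_integral_nonmeasurable => // t pt; have [m tmt pe] := le t pt.
  apply: (le_trans pe); apply: (@le_trans _ _ (\sum_(0 <= k < m.+1) step e node k t)%E).
    rewrite big_nat_recr//= {2}/step indicE mem_set ?mule1; last by rewrite /= in_itv.
    by rewrite leeDr// sume_ge0// => k _; exact: step_ge0.
  by apply: nneseries_lim_ge => k _ _; exact: step_ge0.
rewrite integral_nneseries//; last first.
- by move=> m t _; exact: step_ge0.
- by move=> m; exact: measurable_step.
apply: lee_nneseries => m _; last exact: (integral_step _ _).1.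
by move=> _; apply: integral_ge0 => t _; exact: step_ge0.
Qed.

Lemma steps_le_integral (phi : R -> \bar R) (e node : nat -> R) M :
  (forall t, pos t -> (0 <= phi t)%E) -> (forall m, 0 <= e m) ->
  0 < node 0%N -> {homo node : m k / (m <= k)%N >-> m <= k} ->
  (forall m t, node m <= t < node m.+1 -> ((e m)%:E <= phi t)%E) ->
  ((\sum_(m < M) e m * (node m.+1 - node m))%:E <= \int[mu]_(t in pos) phi t)%E.
Proof.
move=> phi0 e0 t0 tm le.
apply: (@le_trans _ _ (\int[mu]_(t in pos) \sum_(m < M) step e node m t)%E).
  rewrite ge0_integral_sum//; last first.
  - by move=> m t _; exact: step_ge0.
  - by move=> m; exact: measurable_step.
  rewrite -sumEFin; apply: lee_sum => m _.
  rewrite (integral_step _ _).2//; first exact: tm.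
  by apply: lt_le_trans t0 _; exact: tm.
apply: ge0_le_integral_nonmeasurable => t pt.
  by rewrite sume_ge0// => m _; exact: step_ge0.
elim: M => [|M IH]; first by rewrite big_ord0; exact: phi0.
rewrite big_ord_recr/= {2}/step indicE; have [|nt] := boolP (t \in _).
  rewrite inE/= in_itv/= => tM; rewrite big1 ?add0e ?mule1; first exact: le.
  move=> m _; rewrite /step indicE memNset ?mule0// => /=; rewrite in_itv/= => /andP[_].
  apply/negP; rewrite -leNgt; apply: le_trans (andP tM).1; exact: tm.
by rewrite mule0 adde0.
Qed.

End StepIntegrals.

(** * Hausdorff content *)

Section HausdorffContent.
Context {R : realType} {n : nat}.
Implicit Types (E : set 'rV[R]_n) (delta : R).

Lemma hausdorff_content_ge0 delta E : (0 <= hausdorff_content delta E)%E.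
Proof.
apply: le_ereal_inf_tmp => _ [D [x [r [r0 _ ->]]]].
by apply: esum_ge0 => i _; rewrite lee_fin powR_ge0.
Qed.

Lemma hausdorff_content_mono delta E E' : E `<=` E' ->
  (hausdorff_content delta E <= hausdorff_content delta E')%E.
Proof.
move=> EE; apply: ereal_inf_le_tmp => _ [D [x [r [r0 E'D ->]]]].
by exists D, x, r; split => //; exact: subset_trans E'D.
Qed.

Lemma hausdorff_content_eball delta E z r : 0 < r -> E `<=` eball z r ->
  (hausdorff_content delta E <= (r `^ delta)%:E)%E.
Proof.
move=> r0 Er; apply: ereal_inf_lbound; exists [set 0%N], (fun=> z), (fun=> r); split => //.
  by move=> x /Er xr; exists 0%N.
by rewrite esum_set1// lee_fin powR_ge0.
Qed.

Lemma john_domain_subset_eball alpha beta (Omega : set 'rV[R]_n) :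
  john_domain alpha beta Omega -> exists z, Omega `<=` eball z (2 * beta).
Proof.
move=> [/andP[a0 ab] _ [x0 Ox0 john]]; exists x0 => x Ox.
have [l [g [/andP[l0 lb] arc <- gl _]]] := john x Ox.
rewrite /eball/= -gl /enorm.
have -> : \sum_(i < n) (g 0 - g l) ord0 i ^+ 2 = \sum_(i < n) (g l - g 0) ord0 i ^+ 2.
  by apply: eq_bigr => i _; rewrite !mxE -sqrrN opprB.
rewrite -/(enorm (g l - g 0)).
apply: le_lt_trans (arc_length_lipschitz arc (lexx _) l0 (lexx _)) _; lra.
Qed.

End HausdorffContent.

(** * Dyadic sums *)

Section DyadicSums.
Context {R : realType}.

Lemma nneseries_le_bound (f : nat -> R) (X : R) : (forall m, 0 <= f m) ->
  (forall M, \sum_(m < M) f m <= X) -> (\sum_(0 <= m <oo) (f m)%:E <= X%:E)%E.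
Proof.
move=> f0 fX; apply: lime_le.
  by apply: is_cvg_nneseries => m _ _; rewrite lee_fin.
by apply: nearW => M; rewrite sumEFin lee_fin big_mkord.
Qed.

Lemma sum_geometric_le (rho : R) (k M : nat) : 1 < rho ->
  \sum_(m < M) (if (m <= k)%N then rho ^+ m else 0) <= rho ^+ k * (rho / (rho - 1)).
Proof.
move=> r1; have r0 : 0 < rho - 1 by rewrite subr_gt0.
suff : \sum_(m < M) (if (m <= k)%N then rho ^+ m else 0) <= rho ^+ (minn M k.+1) / (rho - 1).
  move=> /le_trans; apply; rewrite mulrA -exprSr ler_pM2r ?invr_gt0//.
  by rewrite ler_eXn2l// geq_minr.
elim: M => [|M IH]; first by rewrite big_ord0 divr_ge0// ?exprn_ge0 ?ltW//; lra.
rewrite big_ord_recr/=; apply: le_trans (lerD IH (lexx _)) _.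
have [Mk|kM] := leqP M k; last first.
  by rewrite addr0 (minn_idPr _)// (minn_idPr _)// ltnW.
rewrite (minn_idPl _)//; last exact: leqW.
have -> : minn M.+1 k.+1 = M.+1 by apply/minn_idPl.
rewrite le_eqVlt; apply/orP; left; apply/eqP; rewrite exprS.
by field; rewrite gt_eqF.
Qed.

Lemma exprn_powR (m : nat) (a : R) : (2 ^+ m) `^ a = (2 `^ a) ^+ m :> R.
Proof. by rewrite -powR_mulrn// -powRrM mulrC powRrM powR_mulrn ?powR_ge0. Qed.

Context (h : nat -> R) (p s tot : R).
Context (h0 : forall k, 0 <= h k) (sp : s < p)
        (htot : forall M, \sum_(k < M) (2 ^+ k) `^ p * h k <= tot).

(** Real terms vanishing below [m] rather than a sum from [m] on, so that the
    summations over [k] and [m] can be exchanged. *)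
Definition level_tail (m : nat) : \bar R :=
  (\sum_(0 <= k <oo) (if (m <= k)%N then (2 ^+ k) `^ s * h k else 0)%:E)%E.

Let term_ge0 m k : 0 <= (if (m <= k)%N then (2 ^+ k) `^ s * h k else 0).
Proof. by case: ifP => // _; rewrite mulr_ge0 ?powR_ge0. Qed.

Lemma level_tail_ge m M :
  ((\sum_(k < M | (m <= k)%N) (2 ^+ k) `^ s * h k)%:E <= level_tail m)%E.
Proof.
rewrite big_mkcond/= -(big_mkord xpredT (fun k => if (m <= k)%N then (2 ^+ k) `^ s * h k else 0)) -sumEFin.
by apply: nneseries_lim_ge => k _ _; rewrite lee_fin.
Qed.

Lemma level_tail_ge0 m : (0 <= level_tail m)%E.
Proof. by apply: nneseries_ge0 => k _ _; rewrite lee_fin. Qed.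

(** Exchange of the two summations: the level [k] receives the geometric sum of
    [2^(m (p - s))] over [m <= k], which is comparable to its last term since [s < p]. *)
Lemma sum_level_tail_le M : (\sum_(m < M) ((2 ^+ m) `^ (p - s))%:E * level_tail m
   <= (2 `^ (p - s) / (2 `^ (p - s) - 1) * tot)%:E)%E.
Proof.
set rho := 2 `^ (p - s); set K := rho / _.
have rho1 : 1 < rho.
  by rewrite /rho powR_expR// -[ltLHS]expR0 ltr_expR mulr_gt0 ?subr_gt0// ln_gt0// ltr1n.
have c0 m : 0 <= (2 ^+ m) `^ (p - s) :> R by exact: powR_ge0.
have -> : (\sum_(m < M) ((2 ^+ m) `^ (p - s))%:E * level_tail m =
  \sum_(0 <= k <oo) (\sum_(m < M) (2 ^+ m) `^ (p - s) *
      (if (m <= k)%N then (2 ^+ k) `^ s * h k else 0))%:E)%E.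
  under [RHS]eq_eseriesr do rewrite -sumEFin.
  rewrite nneseries_sum//; last by move=> m k _; rewrite lee_fin mulr_ge0.
  apply: eq_bigr => m _; rewrite /level_tail -nneseriesZl; last by move=> k _; rewrite lee_fin.
  by apply: eq_eseriesr => k _; rewrite EFinM.
apply: nneseries_le_bound => [k|N].
  by apply: sumr_ge0 => m _; rewrite mulr_ge0.
apply: (@le_trans _ _ (\sum_(k < N) (2 ^+ k) `^ p * h k * K)); last first.
  rewrite -mulr_suml mulrC ler_wpM2l// divr_ge0//; lra.
apply: ler_sum => k _.
have -> : \sum_(m < M) (2 ^+ m) `^ (p - s) * (if (m <= k)%N then (2 ^+ k) `^ s * h k else 0)
  = (\sum_(m < M) (if (m <= k)%N then rho ^+ m else 0)) * ((2 ^+ k) `^ s * h k).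
  rewrite mulr_suml; apply: eq_bigr => m _; rewrite exprn_powR -/rho.
  by case: ifP => _; rewrite ?mul0r ?mulr0.
have H := @sum_geometric_le rho k M rho1.
apply: le_trans (ler_wpM2r (mulr_ge0 (powR_ge0 _ _) (h0 k)) H) _.
have -> : (2 ^+ k) `^ p = rho ^+ k * (2 ^+ k) `^ s.
  rewrite /rho -exprn_powR -powRD ?subrK//.
  by apply/implyP => _; rewrite expf_neq0// pnatr_eq0.
by rewrite le_eqVlt; apply/orP; left; apply/eqP; rewrite /K; ring.
Qed.

Lemma level_tail_fin m : level_tail m \is a fin_num.
Proof.
rewrite ge0_fin_numE ?level_tail_ge0//.
apply: (@le_lt_trans _ _ tot%:E); last exact: ltry.
apply: nneseries_le_bound => // N; apply: le_trans (htot N).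
apply: ler_sum => k _; case: ifP => _; last by rewrite mulr_ge0 ?powR_ge0.
rewrite ler_wpM2r// ler_powR ?(ltW sp)//.
by rewrite exprn_ege1// ler1n.
Qed.

End DyadicSums.

(** * Level sets of the gradient *)

Section LevelSets.
Context {R : realType} {n : nat}.
Implicit Types (E : nat -> set 'rV[R]_n).

Lemma sum_seq_le_esum (D : set nat) (a : nat -> R) (s : seq nat) : uniq s ->
  (forall j, j \in s -> D j) -> ((\sum_(j <- s) a j)%:E <= \esum_(j in D) (a j)%:E)%E.
Proof.
move=> us sD; apply: esum_ge; exists [set` s].
  by split => //; exact: finite_seq.
by rewrite -fsbig_seq// sumEFin.
Qed.

Lemma level_covers E (delta : R) (h err : nat -> R) :
  (forall k, hausdorff_content delta (E k) = (h k)%:E) -> (forall k, 0 < err k) ->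
  exists (D : set (nat * nat)) (cen : nat * nat -> 'rV[R]_n) (rad : nat * nat -> R),
  [/\ forall i, D i -> 0 < rad i,
      forall k z, E k z -> exists j, D (k, j) /\ enorm (z - cen (k, j)) < rad (k, j) &
      forall k s, uniq s -> (forall j, j \in s -> D (k, j)) ->
        \sum_(j <- s) rad (k, j) `^ delta <= h k + err k].
Proof.
move=> hE err0.
have cov k : exists q : set nat * (nat -> 'rV[R]_n) * (nat -> R),
   [/\ forall i, q.1.1 i -> 0 < q.2 i,
       E k `<=` \bigcup_(i in q.1.1) eball (q.1.2 i) (q.2 i) &
       (\esum_(i in q.1.1) (q.2 i `^ delta)%:E < (h k + err k)%:E)%E].
  have [|_ [D [x [r [r0 EDr ->]]]] lt] := lb_ereal_inf_adherent (err0 k) (_ :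
      hausdorff_content delta (E k) \is a fin_num); first by rewrite hE.
  exists (D, x, r); split => //.
  by move: lt; rewrite -/(hausdorff_content delta (E k)) hE -EFinD.
have {cov} [q qP] := choice cov.
exists (fun i => (q i.1).1.1 i.2), (fun i => (q i.1).1.2 i.2), (fun i => (q i.1).2 i.2).
split.
- by move=> [k j] /=; case: (qP k) => + _ _; exact.
- move=> k z Ekz; have [_ cov _] := qP k; have [j Dj zj] := cov _ Ekz.
  by exists j.
- move=> k s us sD; have [_ _ lt] := qP k; rewrite -lee_fin; apply: le_trans (ltW lt).
  exact: (@sum_seq_le_esum _ (fun j => (q k).2 j `^ delta)).
Qed.

(** Sorting a finite family of balls by level reduces it to the bound for each level. *)
Lemma sum_levels_le (D : set (nat * nat)) (rad : nat * nat -> R) (delta q : R)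
    (h : nat -> R) (m : nat) (S : seq (nat * nat)) :
  (forall k, 0 <= h k) ->
  (forall k s, uniq s -> (forall j, j \in s -> D (k, j)) ->
        \sum_(j <- s) rad (k, j) `^ delta <= h k) ->
  uniq S -> {in S, forall i, D i /\ (m <= i.1)%N} ->
  exists M, \sum_(i <- S) (2 ^+ i.1) `^ q * rad i `^ delta
     <= \sum_(k < M | (m <= k)%N) (2 ^+ k) `^ q * h k.
Proof.
move=> h0 hD uS SD; pose M := (\max_(i <- S) i.1).+1; exists M.
have SM i : i \in S -> (i.1 < M)%N by move=> iS; rewrite ltnS leq_bigmax_seq.
have -> : \sum_(i <- S) (2 ^+ i.1) `^ q * rad i `^ delta =
    \sum_(k < M) \sum_(i <- S | i.1 == k :> nat) (2 ^+ i.1) `^ q * rad i `^ delta.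
  rewrite [RHS](exchange_big_dep xpredT)//= big_seq [RHS]big_seq; apply: eq_bigr => i iS.
  by rewrite (big_pred1 (Ordinal (SM _ iS)))// => k; rewrite /= eq_sym.
rewrite [leRHS]big_mkcond/=; apply: ler_sum => k _.
have [mk|km] := leqP m k; last first.
  rewrite big_seq_cond big1// => i /andP[/SD[_ mi] /eqP ik].
  by move: km; rewrite -ik ltnNge mi.
have -> : \sum_(i <- S | i.1 == k :> nat) (2 ^+ i.1) `^ q * rad i `^ delta =
    (2 ^+ k) `^ q * \sum_(j <- [seq i.2 | i <- S & i.1 == k :> nat]) rad (val k, j) `^ delta.
  rewrite big_map big_filter mulr_sumr; apply: eq_bigr => -[a b] /= /eqP ->.
  by [].
rewrite ler_wpM2l ?powR_ge0//; apply: hD.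
  rewrite map_inj_in_uniq ?filter_uniq// => -[a b] [a' b'] /=.
  by rewrite !mem_filter /= => /andP[/eqP -> _] /andP[/eqP -> _] ->.
move=> j /mapP[[a b]]; rewrite mem_filter /= => /andP[/eqP ->] abS ->.
by case: (SD _ abS).
Qed.

(** For [t] between [(sg 2^m / 2)^p] and [(sg 2^m)^p] the set [{g^p > t}] contains
    [{g > sg 2^m}]; the integral is bounded below by the resulting step function. *)
Lemma content_levels_sum (Omega : set 'rV[R]_n) (g : 'rV[R]_n -> R) (sg delta p : R)
    (h : nat -> R) M : 0 < sg -> 0 < p ->
  (forall k, hausdorff_content delta [set x | Omega x /\ 2 ^+ k < g x / sg] = (h k)%:E) ->
  (choquet_integral delta Omega (fun x => (g x `^ p)%:E) <= (sg `^ p)%:E)%E ->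
  \sum_(k < M) (2 ^+ k) `^ p * h k <= (1 - 2 `^ (- p))^-1.
Proof.
move=> sg0 p0 hE le.
have h0 k : 0 <= h k by rewrite -lee_fin -hE hausdorff_content_ge0.
pose node m : R := (sg * 2 ^+ m / 2) `^ p.
have ttE m : node m.+1 - node m = sg `^ p * (1 - 2 `^ (- p)) * (2 ^+ m) `^ p.
  have -> : node m.+1 = sg `^ p * (2 ^+ m) `^ p.
    rewrite /node exprSr mulrA mulfK ?pnatr_eq0//.
    by rewrite powRM ?(ltW sg0)// exprn_ge0.
  have -> : node m = sg `^ p * (2 ^+ m) `^ p * 2 `^ (- p).
    rewrite /node !powRM ?invr_ge0 ?mulr_ge0 ?exprn_ge0 ?(ltW sg0)//.
    by rewrite powRN -[in RHS]powR_inv1 ?powR_ge0// -powRrM mulrN1 -powR_inv1// -powRrM mulN1r.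
  ring.
have p2 : 0 < 1 - 2 `^ (- p).
  rewrite subr_gt0 powR_expR// -[ltRHS]expR0 ltr_expR mulNr oppr_lt0.
  by rewrite mulr_gt0// ln_gt0// ltr1n.
have sgp : 0 < sg `^ p by rewrite powR_gt0.
have tt0 : 0 < node 0%N by rewrite powR_gt0// divr_gt0// mulr_gt0.
have ttm : {homo node : m k / (m <= k)%N >-> m <= k}.
  move=> m k mk; apply: ge0_ler_powR; rewrite ?nnegrE ?(ltW p0)//.
  - by rewrite divr_ge0 ?mulr_ge0 ?exprn_ge0// ltW.
  - by rewrite divr_ge0 ?mulr_ge0 ?exprn_ge0// ltW.
  - by rewrite ler_pM2r ?invr_gt0// ler_pM2l// ler_eXn2l// ltr1n.
rewrite -[leRHS]div1r ler_pdivlMr//.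
have : \sum_(m < M) h m * (node m.+1 - node m) <= sg `^ p.
  rewrite -lee_fin; apply: le_trans le; apply: steps_le_integral => //.
    by move=> t _; exact: hausdorff_content_ge0.
  move=> m t /andP[tmt ttm'].
  rewrite -hE; apply: hausdorff_content_mono => x /= [Ox gx]; split => //.
  rewrite lte_fin; apply: (lt_trans ttm').
  rewrite /node exprSr mulrA mulfK ?pnatr_eq0//.
  have gx' : sg * 2 ^+ m < g x by rewrite mulrC -ltr_pdivlMr.
  have sm0 : 0 <= sg * 2 ^+ m by rewrite mulr_ge0 ?exprn_ge0 ?ltW.
  by apply: gt0_ltr_powR => //; rewrite nnegrE// (le_trans sm0)// ltW.
have -> : \sum_(m < M) h m * (node m.+1 - node m) =
    sg `^ p * ((\sum_(k < M) (2 ^+ k) `^ p * h k) * (1 - 2 `^ (- p))).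
  by rewrite mulr_suml mulr_sumr; apply: eq_bigr => m _; rewrite ttE; ring.
by rewrite ger_pMr.
Qed.

End LevelSets.

(** * The inequality at a given scale *)

Section PoincareSobolev.
Context {R : realType} {n : nat}.

Lemma dense_set_antimono (D : set (nat * nat)) (cen : nat * nat -> 'rV[R]_n)
    (rad : nat * nat -> R) (delta s : R) (k m : nat) : 0 < s -> (k <= m)%N ->
  dense_set D cen rad delta s m `<=` dense_set D cen rad delta s k.
Proof.
move=> s0 km x [t [S [t0 uS SD le]]]; exists t, S; split => //.
  by move=> i /SD[Di mi xi]; split => //; exact: leq_trans mi.
apply: le_trans le; rewrite ler_wpM2r ?powR_ge0//.
apply: ge0_ler_powR; rewrite ?nnegrE ?exprn_ge0 ?(ltW s0)//.
by rewrite ler_eXn2l// ltr1n.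
Qed.

(** The sets [E m] decrease, so a point outside the first one that does not contain
    [Omega] is outside all later ones too.  If every [E m] contains [Omega], any value
    will do. *)
Lemma choose_centre_value (Omega : set 'rV[R]_n) (E : nat -> set 'rV[R]_n)
    (u : 'rV[R]_n -> R) (d : nat -> R) :
  (forall k m, (k <= m)%N -> E m `<=` E k) ->
  (forall m x y, Omega x -> ~ E m x -> Omega y -> ~ E m y -> `|u x - u y| <= d m) ->
  exists b, forall m x, Omega x -> ~ E m x -> `|u x - b| <= d m.
Proof.
move=> Emono osc.
have [exm|nex] := pselect (exists m, `[< (Omega `\` E m) !=set0 >]); last first.
  by exists 0 => m x Ox nx; case: nex; exists m; apply/asboolP; exists x.
case: (ex_minnP exm) => m0 /asboolP[y [Oy ny]] min0.
exists (u y) => m x Ox nx; apply: osc => // Ey; apply: ny.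
by apply: Emono Ey; apply: min0; apply/asboolP; exists x.
Qed.

Lemma sum_half_powers M : \sum_(k < M) (2 ^+ k.+1)^-1 = 1 - (2 ^+ M)^-1 :> R.
Proof.
elim: M => [|M IH]; first by rewrite big_ord0 expr0 invr1 subrr.
rewrite big_ord_recr/= IH exprS invfM.
by field; rewrite expf_neq0// pnatr_eq0.
Qed.

(** Assembly of the proof at scale [sg].  The integral of [|u - b|^q] is bounded above by
    the step function with the value [(2 beta)^delta], a bound for the content of
    [Omega], up to [V], and the bound for the content of the exceptional set of level
    [m] between [V 2^(m p)] and [V 2^((m + 1) p)]. *)
Lemma poincare_at_scale (Omega : set 'rV[R]_n) u (sg alpha beta delta p s : R) :
  0 < delta <= n%:R -> delta / n%:R < s -> s < p -> p < delta ->
  john_domain alpha beta Omega -> C1 Omega u -> 0 < sg ->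
  (choquet_integral delta Omega (fun x => (enorm (gradient u x) `^ p)%:E)
     <= (sg `^ p)%:E)%E ->
  let tot := (1 - 2 `^ (- p))^-1 + 1 in
  let V := (sg * (2 * @osc_const R n (alpha / (2 * beta * n%:R)) beta delta p tot))
             `^ (delta * p / (delta - p)) in
  exists b, (choquet_integral delta Omega
       (fun x => (`|u x - b| `^ (delta * p / (delta - p)))%:E)
     <= (V * ((2 * beta) `^ delta + (12 * n%:R) `^ delta * 2 `^ p *
         (2 `^ (p - s) / (2 `^ (p - s) - 1) * tot)))%:E)%E.
Proof.
move=> dn ds sp pd jO cu sg0 le tot; set q := delta * p / (delta - p) => V.
have /andP[d0 dn'] := dn.
have n0 : 0 < n%:R :> R by exact: lt_le_trans dn'.
have n0' : (0 < n)%N by rewrite -(ltr0n R).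
have s0 : 0 < s by apply: lt_trans ds; rewrite divr_gt0.
have p0 : 0 < p by exact: lt_trans sp.
have dsn : delta <= s * n%:R by rewrite -ler_pdivrMr// ltW.
have dpn : delta <= p * n%:R by rewrite (le_trans dsn)// ler_pM2r// ltW.
have b0 : 0 < beta by case: jO => /andP[a0 ab] _ _; exact: lt_le_trans ab.
have [z0 Oz0] := john_domain_subset_eball jO.
have HO : (hausdorff_content delta Omega <= ((2 * beta) `^ delta)%:E)%E.
  by apply: hausdorff_content_eball Oz0; rewrite mulr_gt0.
have Hfin E : E `<=` Omega -> hausdorff_content delta E \is a fin_num.
  move=> EO; rewrite ge0_fin_numE ?hausdorff_content_ge0//.
  apply: (le_lt_trans (hausdorff_content_mono delta EO)).
  by apply: (le_lt_trans HO); exact: ltry.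
pose E k := [set x | Omega x /\ 2 ^+ k < enorm (gradient u x) / sg].
pose h k := fine (hausdorff_content delta (E k)).
have hE k : hausdorff_content delta (E k) = (h k)%:E.
  by rewrite fineK// Hfin// => x [].
have h0 k : 0 <= h k by rewrite fine_ge0// hausdorff_content_ge0.
(* The errors, weighted by [2^(k p)], add up to at most 1. *)
pose err k : R := (2 ^+ k.+1)^-1 / (2 ^+ k) `^ p.
have err0 k : 0 < err k by rewrite divr_gt0 ?invr_gt0 ?powR_gt0 ?exprn_gt0.
have [D [cen [rad [rad0 cov sumD]]]] := level_covers hE err0.
pose h' k := h k + err k.
have h'0 k : 0 <= h' k by rewrite addr_ge0// ltW.
have h'tot M : \sum_(k < M) (2 ^+ k) `^ p * h' k <= tot.
  have -> : \sum_(k < M) (2 ^+ k) `^ p * h' k =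
      \sum_(k < M) (2 ^+ k) `^ p * h k + \sum_(k < M) (2 ^+ k.+1)^-1.
    rewrite -big_split/=; apply: eq_bigr => k _; rewrite mulrDr; congr (_ + _).
    by rewrite /err mulrCA mulfV ?mulr1// gt_eqF// powR_gt0// exprn_gt0.
  rewrite sum_half_powers lerD ?gerBl ?invr_ge0 ?exprn_ge0//.
  exact: (content_levels_sum M sg0 p0 hE le).
have tot0 : 0 < tot.
  rewrite /tot ltr_wpDl//.
  by have := content_levels_sum 0 sg0 p0 hE le; rewrite big_ord0.
have sumC S : uniq S -> {in S, forall i, D i} ->
    \sum_(i <- S) (2 ^+ i.1) `^ p * rad i `^ delta <= tot.
  move=> uS SD; have [|M le'] := @sum_levels_le R D rad delta p h' 0%N S h'0 sumD uS.
    by move=> i /SD.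
  exact: le_trans le' (h'tot M).
have htail m S : uniq S -> {in S, forall i : nat * nat, D i /\ (m <= i.1)%N} ->
    \sum_(i <- S) (2 ^+ i.1) `^ s * rad i `^ delta <= fine (level_tail h' s m).
  move=> uS SD; have [M le'] := @sum_levels_le R D rad delta s h' m S h'0 sumD uS SD.
  apply: (le_trans le'); rewrite -lee_fin fineK; last exact: (level_tail_fin h'0 sp h'tot).
  exact: level_tail_ge.
pose B m := dense_set D cen rad delta s m.
pose e m := (12 * n%:R) `^ delta * (fine (level_tail h' s m) / (2 ^+ m) `^ s).
have T0 m : 0 <= fine (level_tail h' s m) by rewrite fine_ge0// level_tail_ge0.
have HB m : (hausdorff_content delta (B m) <= (e m)%:E)%E.
  exact: (@dense_set_content R n D cen rad delta s _ m n0' d0 (T0 m) (@htail m)).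
have e0 m : 0 <= e m by rewrite mulr_ge0 ?powR_ge0// divr_ge0 ?powR_ge0.
set Co := 2 * @osc_const R n _ _ _ _ _ in V *.
have pp : 0 < p < delta by rewrite p0.
have Gcov k z : Omega z -> 2 ^+ k < enorm (gradient u z) / sg ->
    exists j, D (k, j) /\ enorm (z - cen (k, j)) < rad (k, j).
  by move=> Oz gz; apply: cov.
have [b bP] := @choose_centre_value Omega B u (fun m => sg * Co * (2 ^+ m) `^ (1 - p / delta))
  (fun k m km => @dense_set_antimono D cen rad delta s k m s0 km)
  (fun m x y Ox nx Oy ny => john_oscillation dn dpn pp dsn s0 tot0 sg0 jO cu rad0 sumC Gcov Ox nx Oy ny).
exists b.
pose node m : R := if m is k.+1 then V * (2 ^+ k) `^ p else 0.
pose ee m : R := if m is k.+1 then e k else (2 * beta) `^ delta.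
have Co0 : 0 < Co.
  rewrite mulr_gt0// osc_const_gt0// divr_ge0 ?mulr_ge0 ?(ltW b0) ?(ltW n0)//.
  by case: jO => /andP[a0 _] _ _; exact: ltW.
have sgCo0 : 0 < sg * Co by rewrite mulr_gt0.
have V0 : 0 < V by rewrite powR_gt0.
have dp0 : 0 < delta - p by rewrite subr_gt0.
have q0 : 0 < q by rewrite divr_gt0// mulr_gt0.
have bP' m x : Omega x -> ~ B m x -> `|u x - b| `^ q <= V * (2 ^+ m) `^ p.
  move=> Ox nx; have := bP m x Ox nx; set W := (2 ^+ m : R) => le'.
  have W0 : 0 < W by rewrite exprn_gt0.
  have -> : V * W `^ p = (sg * Co * W `^ (1 - p / delta)) `^ q.
    rewrite [RHS]powRM ?powR_ge0 ?(ltW sgCo0)// -powRrM.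
    congr (_ * _ `^ _); rewrite /q; field.
    by rewrite !gt_eqF.
  apply: ge0_ler_powR => //; rewrite ?nnegrE ?(ltW q0)//.
  by apply: mulr_ge0; [exact: ltW|exact: powR_ge0].
have ttm m : node m <= node m.+1.
  case: m => [|m] /=; first by rewrite mulr_ge0 ?powR_ge0 ?(ltW V0).
  rewrite ler_pM2l//; apply: ge0_ler_powR; rewrite ?nnegrE ?exprn_ge0 ?(ltW p0)//.
  by rewrite ler_eXn2l// ltr1n.
have ee0 m : 0 <= ee m by case: m => [|m] /=; [exact: powR_ge0|exact: e0].
apply: (@le_trans _ _ (\sum_(0 <= m <oo) (ee m * (node m.+1 - node m))%:E)%E).
  apply: integral_le_steps => //.
    by move=> t _; exact: hausdorff_content_ge0.
  move=> t; rewrite /= in_itv/= andbT => t0.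
  have ext : exists m, t < node m.+1.
    pose N := Num.bound ((t / V) `^ p^-1); exists N => /=.
    rewrite mulrC -ltr_pdivrMr//.
    have -> : t / V = ((t / V) `^ p^-1) `^ p.
      by rewrite -powRrM mulVf ?gt_eqF// powRr1// divr_ge0// ltW.
    apply: gt0_ltr_powR; rewrite ?nnegrE ?powR_ge0 ?exprn_ge0//.
    apply: (lt_trans (archi_boundP (powR_ge0 _ _))).
    by rewrite -/N -natrX ltr_nat ltn_expl.
  case: (ex_minnP ext) => m tm minm; exists m.
    rewrite tm andbT; case: m tm minm => [|m] tm minm; first exact: ltW.
    by rewrite leNgt; apply/negP => /minm; rewrite ltnn.
  case: m tm minm => [|m] tm minm /=.
    by apply: le_trans HO; apply: hausdorff_content_mono => x [].
  apply: le_trans (HB m); apply: hausdorff_content_mono => x /= [Ox].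
  rewrite lte_fin => tx; apply: contrapT => nx.
  have : t < node m.+1 by apply: lt_le_trans tx _; exact: bP'.
  by move=> /minm; rewrite ltnn.
apply: nneseries_le_bound => [m|M].
  by rewrite mulr_ge0 ?ee0// subr_ge0.
have sumT : \sum_(m < M) (2 ^+ m) `^ (p - s) * fine (level_tail h' s m)
    <= 2 `^ (p - s) / (2 `^ (p - s) - 1) * tot.
  rewrite -lee_fin; apply: le_trans (sum_level_tail_le h'0 sp h'tot M).
  rewrite -sumEFin; apply: lee_sum => m _; rewrite EFinM fineK//.
  exact: (level_tail_fin h'0 sp h'tot).
apply: (@le_trans _ _ (\sum_(m < M.+1) ee m * (node m.+1 - node m))).
  by rewrite big_ord_recr/= lerDl mulr_ge0 ?ee0// subr_ge0.
rewrite big_ord_recl/= expr0 powR1 mulr1 subr0 mulrDr [_ `^ delta * V]mulrC lerD2l.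
apply: (@le_trans _ _ (V * (12 * n%:R) `^ delta * 2 `^ p *
   \sum_(m < M) (2 ^+ m) `^ (p - s) * fine (level_tail h' s m))); last first.
  rewrite -!mulrA ler_pM2l// ler_wpM2l ?powR_ge0// ler_wpM2l ?powR_ge0//.
  by rewrite mulrA.
rewrite mulr_sumr; apply: ler_sum => m _.
apply: (@le_trans _ _ (e m * (V * (2 ^+ m.+1) `^ p))).
  rewrite add0n /bump leq0n add1n.
  by rewrite ler_wpM2l ?e0// gerBl mulr_ge0 ?powR_ge0 ?(ltW V0).
rewrite exprS powRM ?exprn_ge0// powRB; last first.
  by apply/implyP => _; rewrite expf_neq0// pnatr_eq0.
by rewrite le_eqVlt; apply/orP; left; apply/eqP; rewrite /e; ring.
Qed.

End PoincareSobolev.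

(** * The Poincare-Sobolev inequality *)

Theorem corollary1p1 (R : realType) (n : nat) (delta p alpha beta : R) :
  (2 <= n)%N ->
  0 < delta <= n%:R ->
  delta / n%:R < p < delta ->
  0 < alpha <= beta ->
  exists2 c : R, 0 < c &
    forall Omega : set 'rV[R]_n, john_domain alpha beta Omega ->
    forall u : 'rV[R]_n -> R, C1 Omega u ->
      (ereal_inf [set (choquet_integral delta Omega
                         (fun x => (`|u x - b| `^ (delta * p / (delta - p)))%:E))
                      `^ ((delta - p) / (delta * p)) | b in [set: R]]
       <= c%:E * (choquet_integral delta Omega
                    (fun x => (enorm (gradient u x) `^ p)%:E)) `^ p^-1)%E.
Proof.
move=> n2 dn /andP[dp pd] /andP[a0 ab].
have /andP[d0 _] := dn.
have n0 : 0 < n%:R :> R by rewrite ltr0n ltnW.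
have p0 : 0 < p by apply: lt_trans dp; rewrite divr_gt0.
have dp0 : 0 < delta - p by rewrite subr_gt0.
pose s := (delta / n%:R + p) / 2.
have [ds sp] : delta / n%:R < s /\ s < p by rewrite /s; lra.
pose tot : R := (1 - 2 `^ (- p))^-1 + 1.
pose Co := 2 * @osc_const R n (alpha / (2 * beta * n%:R)) beta delta p tot.
pose F := (2 * beta) `^ delta + (12 * n%:R) `^ delta * 2 `^ p *
         (2 `^ (p - s) / (2 `^ (p - s) - 1) * tot).
set q := delta * p / (delta - p).
have q0 : 0 < q by rewrite divr_gt0// mulr_gt0.
have -> : (delta - p) / (delta * p) = q^-1 by rewrite /q invf_div.
pose c := Num.max (Co * F `^ q^-1) 1.
have c0 : 0 < c by rewrite lt_max ltr01 orbT.
exists c => // Omega jO u cu.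
set I := choquet_integral delta Omega (fun x => (enorm (gradient u x) `^ p)%:E).
have I0 : (0 <= I)%E by apply: integral_ge0 => t _; exact: hausdorff_content_ge0.
have [Ioo|Ifin] := eqVneq I +oo%E.
  by rewrite Ioo poweRyr ?invr_eq0 ?gt_eqF// gt0_muley ?leey.
have {}Ifin : I \is a fin_num by rewrite ge0_fin_numE// ltey.
set r := fine I; have IE : I = r%:E by rewrite fineK.
have r0 : 0 <= r by rewrite fine_ge0.
rewrite IE poweR_EFin -EFinM; apply/lee_addgt0Pr => e e0.
pose sg := r `^ p^-1 + e / c.
have ec : 0 < e / c by rewrite divr_gt0.
have sg0 : 0 < sg by rewrite ltr_wpDl ?powR_ge0.
have rsg : r <= sg `^ p.
  have -> : r = (r `^ p^-1) `^ p by rewrite -powRrM mulVf ?gt_eqF// powRr1.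
  apply: ge0_ler_powR; rewrite ?nnegrE ?powR_ge0 ?(ltW sg0) ?(ltW p0)//.
  by rewrite lerDl ltW.
have [|b bP] := @poincare_at_scale R n Omega u sg alpha beta delta p s dn ds sp pd jO cu sg0.
  by rewrite -/I IE lee_fin.
rewrite -/tot -/Co -/F -/q in bP.
set J := choquet_integral _ _ _ in bP.
have J0 : (0 <= J)%E by apply: integral_ge0 => t _; exact: hausdorff_content_ge0.
apply: (@le_trans _ _ (J `^ q^-1)%E); first by apply: ereal_inf_lbound; exists b.
have Jfin : J \is a fin_num by rewrite ge0_fin_numE// (le_lt_trans bP)// ltry.
have JE : J = (fine J)%:E by rewrite fineK.
rewrite JE lee_fin in bP; rewrite JE poweR_EFin -EFinD lee_fin.
apply: (@le_trans _ _ (((sg * Co) `^ q * F) `^ q^-1)).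
  apply: ge0_ler_powR; rewrite ?nnegrE ?invr_ge0 ?(ltW q0) ?fine_ge0//.
  by apply: le_trans bP; exact: fine_ge0.
have Co0 : 0 < Co.
  rewrite mulr_gt0// osc_const_gt0 ?p0//; first exact: ltnW.
  by rewrite divr_ge0 ?mulr_ge0 ?(ltW a0) ?(ltW n0) ?(le_trans (ltW a0) ab).
have sgCo0 : 0 < sg * Co by rewrite mulr_gt0.
have F0 : 0 <= F.
  rewrite -(pmulr_rge0 _ (powR_gt0 q sgCo0)).
  by apply: le_trans bP; exact: fine_ge0.
rewrite powRM ?powR_ge0// -powRrM divff ?gt_eqF// powRr1 ?(ltW sgCo0)//.
rewrite -mulrA; apply: (@le_trans _ _ (sg * c)).
  by rewrite ler_pM2l// le_max lexx.
by rewrite /sg mulrDl divfK ?gt_eqF// mulrC.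
Qed.
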